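(* Let $s>0$ and $\sigma>-1/2$. There are $C^{(4)},C^{(5)}>0$, depending only on $\sigma$ and $s$, such that, for all integers $k\ge 1$: (i) $\max_{x\in\mathbb{R}}\xi_k^2(x)\ge C^{(4)}k^{-1/6}$; and (ii) if $k$ is even and $\sigma<0$, then $\max_{|x|\ge x_{k,k/2}}\xi_k^2(x)\ge C^{(5)}k^{-1/6}$.
   Context: Fix $s>0$ and $\sigma>-1/2$. Let $p_k$ ($k=0,1,2,\dots$) be the orthonormal polynomials for the measure $e^{-sx^2}|x|^{2\sigma}\,dx$ on $\mathbb{R}$: $p_k$ has degree $k$, positive leading coefficient, and $\int_{-\infty}^{\infty}p_k p_\ell\,|x|^{2\sigma}e^{-sx^2}\,dx=\delta_{k\ell}$. Each $p_k$ has $k$ simple real zeros, denoted $x_{k,k}<x_{k,k-1}<\dots<x_{k,1}$; if $k\geq 2$ is even, $x_{k,k/2}$ is the smallest positive zero of $p_k$. Put $\xi_k(x)=|x|^\sigma p_k(x)e^{-sx^2/2}$. The function $\xi_k$ is defined on $\mathbb{R}\setminus\{0\}$, and also at $0$ by continuity if $k$ is odd or $\sigma\ge 0$. If $k$ is even and $\sigma<0$, then $\xi_k$ is not defined at $0$ and is unbounded near $0$; in that case the maximum over $\mathbb{R}$ in (i) is understood as the supremum over $\mathbb{R}\setminus\{0\}$, which is $+\infty$. *)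

(* Defs.v *)
From mathcomp Require Import all_boot all_order all_algebra.
From mathcomp Require Import polyrcf.
From mathcomp Require Import all_classical all_reals all_analysis.

Set Implicit Arguments.
Unset Strict Implicit.
Unset Printing Implicit Defensive.

Import Order.TTheory GRing.Theory Num.Theory.
Import numFieldNormedType.Exports.

Local Open Scope classical_set_scope.
Local Open Scope ring_scope.

(* For sigma != 0 the value at x = 0 is 0 by the convention 0 `^ a = 0;
   it does not affect Lebesgue integrals. *)
Definition weight {R : realType} (s sigma x : R) : R :=
  `|x| `^ (2 * sigma) * expR (- (s * x ^+ 2)).

(* The integral is the extended-real Lebesgue integral, whose value is finite
   only for an integrable integrand (in particular +oo - +oo is -oo). *)
Definition orthonormal_polys {R : realType} (s sigma : R)
    (p : nat -> {poly R}) : Prop :=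
  [/\ forall k, size (p k) = k.+1,
      forall k, 0 < lead_coef (p k) &
      forall k l, (\int[lebesgue_measure]_x
        ((p k).[x] * (p l).[x] * weight s sigma x)%:E
        = ((k == l)%:R : R)%:E)%E].

(* x_{k,j}, 1 <= j <= k: the j-th largest real zero of p k
   (rootsR lists the distinct real roots in increasing order). *)
Definition zero_of {R : realType} (p : nat -> {poly R}) (k j : nat) : R :=
  nth 0 (rev (rootsR (p k))) j.-1.

(* At x = 0 this is the continuous extension when k is odd or sigma >= 0:
   0 `^ sigma is 1 if sigma = 0 and 0 otherwise.  When k is even and
   sigma < 0 the value at 0 is meaningless and must be excluded. *)
Definition xi {R : realType} (s sigma : R) (p : nat -> {poly R})
    (k : nat) (x : R) : R :=
  `|x| `^ sigma * (p k).[x] * expR (- (s * x ^+ 2) / 2).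

Definition is_max_on {R : realType} (D : set R) (f : R -> R) (M : R) : Prop :=
  (exists2 x, D x & f x = M) /\ (forall x, D x -> f x <= M).

(* "max over the real line of xi_k^2 >= c": a genuine maximum when xi_k is
   defined everywhere, the supremum in [0, +oo] over the nonzero reals
   when k is even and sigma < 0. *)
Definition max_xi2_ge {R : realType} (s sigma : R) (p : nat -> {poly R})
    (k : nat) (c : R) : Prop :=
  if ~~ odd k && (sigma < 0) then
    (c%:E <= ereal_sup
      [set (xi s sigma p k x ^+ 2)%:E | x in [set x : R | x != 0%R]])%E : Prop
  else
    exists2 M, is_max_on setT (fun x => xi s sigma p k x ^+ 2) M & c <= M.

(* Main.v *)
Require Import Defs.
From mathcomp Require Import all_boot all_order all_algebra.
From mathcomp Require Import polyrcf zify ring lra.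
From mathcomp Require Import all_classical all_reals all_analysis.
From mathcomp Require Import measurable_realfun.

(** The proof rests on an exact identity: if [y != 0] is a zero of [p k], then
    the integral of [xi k ^ 2 / (x - y) ^ 2] equals [2 s].  It follows from the
    integration by parts [L ((x P)') + 2 sigma L P = 2 s L (x ^ 2 P)] for the
    functional [L] of the weight, applied to [P = (p k) ^ 2 / (x ^ 2 - y ^ 2)].
    Integration by parts also yields the differential equation
    [xi'' = - Q xi], where [Q] vanishes near the turning point
    [T ~ sqrt (2 k / s)].  By Sturm comparison [p k] has a zero [y] with
    [T - y] of order [k ^ (- 1/6)]; there [Q] is of order [k ^ (1/3)], so by
    Landau's inequality [xi'] is at most of order [m k ^ (1/6)] when [m] bounds
    [xi].  Hence the part [|x - y| <= s ^ (- 1/2)] of the integral is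
    [O (m ^ 2 k ^ (1/6))], while the rest is at most [s] since [xi] has norm 1;
    so [m ^ 2] is at least of order [k ^ (- 1/6)].  Only the values of [xi] near
    the turning point are used, hence the same bound beyond the smallest
    positive zero.  The finitely many remaining [k] are harmless because the
    orthonormal polynomials are unique. *)

Set Implicit Arguments.
Unset Strict Implicit.
Unset Printing Implicit Defensive.
Import Order.TTheory GRing.Theory Num.Theory.
Import numFieldNormedType.Exports.
Local Open Scope classical_set_scope.
Local Open Scope ring_scope.

(** * Orthonormal polynomials for a symmetric functional *)

Section polynomial_functionals.
Context {R : comNzRingType}.
Implicit Types (f g : {poly R} -> R) (P Q : {poly R}).

Definition linear_functional f :=
  forall a P Q, f (a *: P + Q) = a * f P + f Q.

Lemma linear_functionalD f P Q :
  linear_functional f -> f (P + Q) = f P + f Q.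
Proof. by move=> lf; rewrite -{1}[P]scale1r lf mul1r. Qed.

Lemma linear_functional0 f : linear_functional f -> f 0 = 0.
Proof.
by move=> lf; apply/(@addrI _ (f 0)); rewrite -linear_functionalD// !addr0.
Qed.

Lemma linear_functionalZ f a P : linear_functional f -> f (a *: P) = a * f P.
Proof.
by move=> lf; rewrite -{1}[a *: P]addr0 lf (linear_functional0 lf) addr0.
Qed.

Lemma linear_functionalB f P Q :
  linear_functional f -> f (P - Q) = f P - f Q.
Proof.
move=> lf; rewrite addrC -scaleN1r lf; ring.
Qed.

Lemma linear_functional_sum f (I : Type) (r : seq I) (F : I -> {poly R}) :
  linear_functional f -> f (\sum_(i <- r) F i) = \sum_(i <- r) f (F i).
Proof.
move=> lf; elim: r => [|i r IH]; first by rewrite !big_nil linear_functional0.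
by rewrite !big_cons linear_functionalD// IH.
Qed.

Lemma linear_functional_ext f g :
  linear_functional f -> linear_functional g ->
  (forall n, f 'X^n = g 'X^n) -> f =1 g.
Proof.
move=> lf lg fg P; rewrite -[P]coefK poly_def.
rewrite !linear_functional_sum//; apply: eq_bigr => i _.
by rewrite !linear_functionalZ// fg.
Qed.

End polynomial_functionals.

(** Counting roots: the [size P] distinct points [a + 1, a + 2, ...] are too many to be all roots of
    [P]. *)
Lemma poly_neq0_gt {R : realFieldType} (P : {poly R}) (a : R) : P != 0 ->
  exists2 x, a < x & P.[x] != 0.
Proof.
move=> P0; apply: contrapT => h.
have : (size [seq (a + i.+1%:R)%R | i <- iota 0 (size P)] < size P)%N.
  apply: max_poly_roots => //.
    apply/allP => _ /mapP[i _ ->]; apply/negP => Pi; apply: h.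
    by exists (a + i.+1%:R); rewrite ?ltrDl ?ltr0n//; apply/negP.
  rewrite map_inj_uniq ?iota_uniq// => i j /addrI/eqP.
  by rewrite eqr_nat => /eqP[].
by rewrite size_map size_iota ltnn.
Qed.

Lemma lead_coef_comp_oppX {R : idomainType} (P : {poly R}) n :
  size P = n.+1 -> lead_coef (P \Po - 'X) = (-1) ^+ n * lead_coef P.
Proof.
move=> sP; rewrite lead_coef_comp ?size_polyN ?size_polyX//.
by rewrite lead_coefN lead_coefX sP /= mulrC.
Qed.

Lemma coef_comp_oppX {R : comNzRingType} (P : {poly R}) i :
  (P \Po - 'X)`_i = (-1) ^+ i * P`_i.
Proof.
have E j : (- 'X) ^+ j = ((-1) ^+ j)%:P * 'X^j :> {poly R}.
  by rewrite (exprNn 'X) polyC_exp polyCN.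
rewrite poly.coef_comp_poly.
have [iP|Pi] := ltnP i (size P).
  rewrite (bigD1 (Ordinal iP))//= big1 => [|j /eqP/val_eqP/= ji].
    by rewrite E coefCM coefXn eqxx mulr1 addr0 mulrC.
  by rewrite E coefCM coefXn eq_sym (negbTE ji) !mulr0.
rewrite big1 => [|j _]; first by rewrite nth_default ?mulr0.
rewrite E coefCM coefXn gtn_eqF ?mulr0//.
exact: leq_trans (ltn_ord j) Pi.
Qed.

Lemma size_deriv_leq {R : nzRingType} (P : {poly R}) : (size P^`() <= size P)%N.
Proof.
have [->|P0] := eqVneq P 0; first by rewrite deriv0.
exact/ltnW/lt_size_deriv.
Qed.

Section orthonormal_family.
Context {R : realFieldType}.
Variables (L : {poly R} -> R).
Hypothesis linL : linear_functional L.
Implicit Types (P Q : {poly R}).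

Let LD P Q : L (P + Q) = L P + L Q. Proof. exact: linear_functionalD. Qed.
Let LZ a P : L (a *: P) = a * L P. Proof. exact: linear_functionalZ. Qed.
Let LB P Q : L (P - Q) = L P - L Q. Proof. exact: linear_functionalB. Qed.

Definition orthonormal_for (p : nat -> {poly R}) :=
  [/\ forall k, size (p k) = k.+1, forall k, 0 < lead_coef (p k) &
      forall k l, L (p k * p l) = (k == l)%:R].

Lemma poly_span (p : nat -> {poly R}) : (forall k, size (p k) = k.+1) ->
  forall n P, (size P <= n)%N ->
    exists c : nat -> R, P = \sum_(j < n) c j *: p j.
Proof.
move=> sp; elim=> [|n IH] P sP.
  exists (fun=> 0); rewrite big_ord0.
  by apply/eqP; rewrite -size_poly_eq0 -leqn0.
have ln : (p n)`_n != 0.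
  have := lead_coef_eq0 (p n); rewrite lead_coefE sp /= => ->.
  by rewrite -size_poly_eq0 sp.
pose a := P`_n / (p n)`_n.
have [|c cE] := IH (P - a *: p n).
  apply/leq_sizeP => j; rewrite leq_eqVlt => /predU1P[<-|nj].
    by rewrite !coefE /a; field.
  rewrite !coefE !nth_default ?mulr0 ?subrr ?sp//.
  exact: leq_trans sP _.
exists (fun j => if (j < n)%N then c j else a).
rewrite big_ord_recr/= ltnn -[LHS](subrK (a *: p n)) cE; congr (_ + _).
by apply: eq_bigr => i _; rewrite ltn_ord.
Qed.

Lemma orthonormal_low p k P : orthonormal_for p ->
  (size P <= k)%N -> L (p k * P) = 0.
Proof.
case=> sp _ op /(poly_span sp)[c ->].
rewrite mulr_sumr linear_functional_sum// big1// => i _.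
by rewrite -scalerAr LZ op gtn_eqF ?mulr0.
Qed.

(** The difference [r] has degree below [k], so it is orthogonal to [p k] and to [q k]. Comparing
    norms gives [c ^ 2 = 1], and [c = 1] by the signs of the leading coefficients. Then [r] is
    orthogonal to every [p j] with [j < k] as well, so its coordinates in that basis vanish. *)
Lemma orthonormal_uniq p q : orthonormal_for p -> orthonormal_for q -> p =1 q.
Proof.
move=> op oq; have [sp lp pp] := op; have [sq lq qq] := oq => k.
pose c := lead_coef (p k) / lead_coef (q k).
have c0 : 0 < c by rewrite divr_gt0.
pose r := p k - c *: q k.
have sr : (size r <= k)%N.
  apply/leq_sizeP => j; rewrite leq_eqVlt => /predU1P[<-|nj].
    have := lt0r_neq0 (lq k).
    by rewrite !coefE /c !lead_coefE sp sq /= => ?; field.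
  by rewrite !coefE !nth_default ?mulr0 ?subrr ?sp ?sq.
have pE : p k = c *: q k + r by rewrite /r addrC subrK.
have h1 : c * L (p k * q k) = 1.
  have := pp k k; rewrite eqxx {2}pE mulrDr LD (orthonormal_low op sr) addr0.
  by rewrite -scalerAr LZ.
have h2 : L (p k * q k) = c.
  rewrite pE mulrDl LD [r * _]mulrC (orthonormal_low oq sr) addr0.
  by rewrite -scalerAl LZ qq eqxx mulr1.
have c1 : c = 1.
  apply/eqP; rewrite -(@eqrXn2 _ 2)//; last exact: ltW.
  by rewrite expr1n expr2 -[X in _ * X]h2 h1.
have r0 : r = 0.
  have [d rE] := poly_span sp sr.
  rewrite rE big1// => j _.
  have := (orthonormal_low oq (k := k) (P := p j)); rewrite sp => /(_ (ltn_ord j)) h.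
  have : L (p j * r) = 0.
    rewrite /r mulrBr LB -scalerAr LZ [_ * q k]mulrC h mulr0 subr0.
    by rewrite pp ltn_eqF.
  rewrite rE mulr_sumr linear_functional_sum// (bigD1 j)//= big1 => [|i ij].
    by rewrite -scalerAr LZ pp eqxx mulr1 addr0 => ->; rewrite scale0r.
  by rewrite -scalerAr LZ pp eq_sym (negbTE ij : (val i == val j) = _) mulr0.
by rewrite pE r0 c1 scale1r addr0.
Qed.

Hypothesis L_refl : forall P, L (P \Po - 'X) = L P.

(** Since [L] is invariant under reflection, the reflected polynomials with the sign [(-1) ^ j]
    restored are again orthonormal; uniqueness identifies them with the original ones. *)
Lemma orthonormal_parity p k : orthonormal_for p ->
  p k \Po - 'X = (-1) ^+ k *: p k.
Proof.
move=> op; have [sp lp pp] := op.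
have sc j : size (p j \Po - 'X) = j.+1.
  by rewrite size_comp_poly2 ?size_polyN ?size_polyX.
suff oq : orthonormal_for (fun j => (-1) ^+ j *: (p j \Po - 'X)).
  by rewrite -[in RHS](orthonormal_uniq oq op k) scalerA -expr2 sqrr_sign scale1r.
split=> [j|j|j l].
- by rewrite size_scale ?signr_eq0.
- by rewrite lead_coefZ (lead_coef_comp_oppX (sp j)) mulrA -expr2 sqrr_sign mul1r.
rewrite -(@scalerAl _ {poly R}) -scalerAr -comp_polyM !LZ L_refl pp.
by case: eqVneq => [->|_]; rewrite ?mulr0// mulrA -expr2 sqrr_sign mul1r.
Qed.


Context (s sigma : R).
(** The functional form of the Pearson equation [x w' = (2 sigma - 2 s x ^ 2) w] of the weight. *)
Hypothesis L_parts : forall P,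
  L ('X * P)^`() + 2 * sigma * L P = 2 * s * L ('X^2 * P).

Lemma odd_moment n : odd n -> L 'X^n = 0.
Proof.
move=> on; have := L_refl 'X^n; rewrite comp_Xn_poly (exprNn 'X) -signr_odd on.
rewrite expr1 mulN1r -scaleN1r LZ => h; lra.
Qed.

Lemma moment_rec n : 2 * s * L 'X^(n.+2) = (n.+1%:R + 2 * sigma) * L 'X^n.
Proof.
have := L_parts 'X^n.
rewrite -exprS derivXn -scaler_nat LZ -exprD add2n /= => <-; ring.
Qed.

Let c n : R := n%:R + 2 * sigma * (odd n)%:R.

(* This is [T^2 - 2 s X T] for the Dunkl operator [T X^n = c n X^(n-1)]; it is
   symmetric for [L] and preserves degrees, so every [p k] is an eigenvector. *)
Definition dunkl_hermite P : {poly R} :=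
  \poly_(i < size P) (c i.+2 * c i.+1 * P`_i.+2 - 2 * s * c i * P`_i).

Lemma coef_dunkl_hermite P i :
  (dunkl_hermite P)`_i = c i.+2 * c i.+1 * P`_i.+2 - 2 * s * c i * P`_i.
Proof.
rewrite coef_poly; case: ltnP => // Pi.
by rewrite !nth_default ?mulr0 ?subrr ?(leqW (leqW Pi)) ?Pi.
Qed.

Lemma linear_dunkl_hermite Q :
  linear_functional (fun P => L (dunkl_hermite P * Q)).
Proof.
move=> a P P'; rewrite -LZ -LD scalerAl -mulrDl; congr (L (_ * _)).
by apply/polyP => i; rewrite !(coefD, coefZ, coef_dunkl_hermite); ring.
Qed.

Lemma dunkl_hermiteXn n : dunkl_hermite 'X^n =
  (c n * c n.-1) *: 'X^(n - 2) - (2 * s * c n) *: 'X^n.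
Proof.
apply/polyP => i; rewrite coef_dunkl_hermite !coefE.
case: n => [|[|n]] /=; rewrite ?subSS ?subn0 ?eqSS.
- by case: i => [|i]; rewrite /c /=; ring.
- by case: i => [|[|i]]; rewrite /c /=; ring.
rewrite -[i == n.+2]eq_sym; case: (eqVneq i n) => [->|_].
  by rewrite eqn_leq ltnNge leqnSn /=; ring.
by case: (eqVneq i n.+2) => [->|_] /=; ring.
Qed.

Let c0 : c 0 = 0.
Proof. by rewrite /c /=; ring. Qed.

(** The right side is [- L (T X^a * T X^b)], so its symmetry in [a] and [b] yields the symmetry of
    the operator. For [a + b] odd both sides vanish; for [a + b] even [moment_rec] applies. Where
    [a + b - 2] truncates, one of [a], [b] is 0 and the factor [c 0 = 0] makes the moment
    irrelevant. *)
Lemma dunkl_hermite_monomials a b :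
  L (dunkl_hermite 'X^a * 'X^b) = - (c a * c b * L 'X^(a + b - 2)).
Proof.
rewrite dunkl_hermiteXn mulrBl -!(@scalerAl _ {poly R}) -!exprD LB !LZ.
have [odd_ab|even_ab] := boolP (odd (a + b)).
  rewrite (odd_moment odd_ab).
  case: a odd_ab => [|[|a]] odd_ab; first by rewrite c0; ring.
    case: b odd_ab => [|b] ob; first by rewrite /= c0; ring.
    by rewrite /= c0 (@odd_moment (1 + b.+1 - 2)); [ring|move: ob; lia].
  by rewrite !odd_moment; [ring|move: odd_ab; lia..].
case: a even_ab => [|[|a]] even_ab; first by rewrite /c /=; ring.
  case: b even_ab => // b /= /negPn ob.
  have := moment_rec b; rewrite /c /= -(negbK (odd b)) ob /= => h.
  rewrite (_ : 1 + b.+1 = b.+2)%N// (_ : 1 + b.+1 - 2 = b)%N; last by lia.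
  have -> : 2 * s * (1 + 2 * sigma * 1) * L 'X^(b.+2) =
    (1 + 2 * sigma) * (2 * s * L 'X^(b.+2)) by ring.
  by rewrite h; ring.
have := moment_rec (a + b).
rewrite (_ : a.+2 - 2 + b = a + b)%N; last by lia.
rewrite (_ : a.+2 + b - 2 = a + b)%N; last by lia.
rewrite (_ : a.+2 + b = (a + b).+2)%N; last by lia.
move=> h.
have -> : 2 * s * c a.+2 * L 'X^((a + b).+2) =
    c a.+2 * (2 * s * L 'X^((a + b).+2)) by ring.
rewrite h /c /=.
have -> : odd b = odd a by move: even_ab => /=; lia.
by case: (odd a) => /=; rewrite -!natr1 natrD; ring.
Qed.

Lemma dunkl_hermite_sym P Q : L (dunkl_hermite P * Q) = L (P * dunkl_hermite Q).
Proof.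
have lin_l P' : linear_functional (fun Q' => L (P' * Q')).
  by move=> a Q' Q''; rewrite mulrDr -scalerAr linL.
have lin_r Q' : linear_functional (fun P' => L (P' * Q')).
  by move=> a P' P''; rewrite mulrDl -scalerAl linL.
have lin_lD P' : linear_functional (fun Q' => L (P' * dunkl_hermite Q')).
  move=> a Q' Q''; rewrite ![P' * _]mulrC; exact: linear_dunkl_hermite.
apply: (linear_functional_ext (linear_dunkl_hermite Q) (lin_r _)) => a.
apply: (linear_functional_ext (lin_l _) (lin_lD _)) => b /=.
rewrite dunkl_hermite_monomials [in RHS]mulrC dunkl_hermite_monomials addnC.
ring.
Qed.

Hypothesis L_pos : forall P, (forall x, 0 <= P.[x]) -> P != 0 -> 0 < L P.

Lemma L_sqr_eq0 P : L (P * P) = 0 -> P = 0.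
Proof.
move=> LP0; apply/eqP; apply: contraT => P0.
have := L_pos (P := P * P); rewrite LP0 ltxx => -> //.
  by move=> x; rewrite hornerM -expr2 sqr_ge0.
by rewrite mulf_neq0.
Qed.

(** The terms of degree [k] cancel in [r], so [r] has degree below [k]. The operator is symmetric
    and does not raise degrees, hence [L (r * r)] reduces to products of [p k] with polynomials of
    lower degree, and is 0. *)
Lemma orthonormal_eigen p k : orthonormal_for p ->
  dunkl_hermite (p k) = - (2 * s * c k) *: p k.
Proof.
move=> op; have [sp lp pp] := op.
pose r := dunkl_hermite (p k) + (2 * s * c k) *: p k.
have sr : (size r <= k)%N.
  apply/leq_sizeP => j; rewrite coefD coefZ coef_dunkl_hermite.
  rewrite leq_eqVlt => /predU1P[<-|kj].
    rewrite [(p k)`_k.+2]nth_default ?sp//; ring.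
  by rewrite !nth_default ?sp//; [ring|lia].
suff /eqP : r = 0 by rewrite addr_eq0 -scaleNr => /eqP.
apply: L_sqr_eq0; rewrite {1}/r mulrDl LD dunkl_hermite_sym -scalerAl LZ.
rewrite !(orthonormal_low op)// ?mulr0 ?addr0//.
exact: leq_trans (size_poly _ _) sr.
Qed.

Lemma coef_parity p k i : orthonormal_for p ->
  odd i != odd k -> (p k)`_i = 0.
Proof.
move=> op ik; have := congr1 (fun P : {poly R} => P`_i) (orthonormal_parity k op).
rewrite /= coef_comp_oppX coefZ -signr_odd -[in RHS]signr_odd.
by move: ik; case: (odd i); case: (odd k) => //= _; rewrite ?expr1 ?expr0 => h; lra.
Qed.

(** On polynomials of one parity the Dunkl operator squared is an ordinary differential operator, so
    the eigenvalue equation becomes a differential equation. The factor ['X^2] clears the poles at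
    0. The identity is checked coefficient by coefficient, those of the wrong parity being 0. *)
Lemma orthonormal_ode p k : orthonormal_for p ->
  'X^2 * (p k)^`()^`() + ((2 * sigma) *: 'X - (2 * s) *: 'X^3) * (p k)^`()
  + ((2 * s * k%:R) *: 'X^2 - (2 * sigma * (odd k)%:R)%:P) * p k = 0.
Proof.
move=> op; have ev i := congr1 (fun P : {poly R} => P`_i) (orthonormal_eigen k op).
apply/polyP => i; rewrite !mulrDl !mulNr -!(@scalerAl _ {poly R}).
rewrite !(coefD, coefN, coefZ, coefXM, coefXnM, coefCM, coef_deriv, coef0).
case: i => [|[|i]] /=.
- have [/esym ok|/(coef_parity op) ->] := eqVneq (odd 0) (odd k); last by ring.
  by rewrite ok /=; ring.
- have [/esym ok|/(coef_parity op) ->] := eqVneq (odd 1) (odd k); last by ring.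
  by rewrite ok /=; ring.
have -> : (if (i.+2 < 3)%N then 0
    else (p k)`_(i.+2 - 3).+1 *+ (i.+2 - 3).+1) = (p k)`_i *+ i.
  by case: i => [|i]; rewrite ?mulr0n// !subSS subn0.
rewrite !subSS subn0.
have [ik|ik] := eqVneq (odd i) (odd k); last first.
  have /(coef_parity op) -> : odd i.+2 != odd k by rewrite /= negbK.
  by rewrite (coef_parity op ik); ring.
have := ev i; rewrite coef_dunkl_hermite coefZ /c /= negbK ik => /eqP.
by rewrite -subr_eq0 => /eqP h; rewrite -[RHS]h; case: (odd k) => /=; ring.
Qed.



Lemma root_oppX p k y : orthonormal_for p -> root (p k) y -> root (p k) (- y).
Proof.
move=> op /rootP py; apply/rootP.
have := congr1 (horner^~ y) (orthonormal_parity k op).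
by rewrite /= horner_comp hornerZ hornerN hornerX py mulr0.
Qed.

(* With [u = p k / (X^2 - y^2)], integration by parts applied to [X * p k * u]
   gives [L (X * (p k)' * u) = 2 s].  Both this and [L (q * q)] are equal to
   [L ((p k)' * q)]: the first because [q = (X + y) u] and [(p k)' * u] is odd,
   the second because [(p k)' = q + (X - y) q']. *)
Lemma sqr_quotient_root p k y q : orthonormal_for p -> y != 0 ->
  p k = q * ('X - y%:P) -> L (q * q) = 2 * s.
Proof.
move=> op y0 pq; have [sp lp pp] := op.
have rp : root (p k) y by rewrite pq rootM root_XsubC eqxx orbT.
have /factor_theorem[u qu] : root q (- y).
  have := root_oppX op rp; rewrite pq rootM => /orP[//|].
  by rewrite root_XsubC -subr_eq0 => /eqP h; case/eqP: y0; lra.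
have pu : p k = u * ('X^2 - (y ^+ 2)%:P).
  by rewrite pq qu polyCN polyC_exp; ring.
have u0 : u != 0.
  by apply: contra_eq_neq (sp k) => u0; rewrite pu u0 mul0r size_poly0.
have su : (size u).+2 = k.+1.
  rewrite -(sp k) pu size_Mmonic ?monicXnsubC//.
  by rewrite size_XnsubC// addnC.
have q0 : q != 0 by apply: contra_eq_neq (sp k) => q0; rewrite pq q0 mul0r size_poly0.
have sq : size q = k.
  by have := sp k; rewrite pq size_Mmonic ?monicXsubC// size_XsubC addn2 => -[].
have su_k : (size u < k)%N by rewrite -ltnS -su.
have low P : (size P <= k)%N -> L (p k * P) = 0 by exact: orthonormal_low.
have h1 : L ('X * (p k * u))^`() = 2 * s.
  have := L_parts (p k * u); rewrite (low u (ltnW su_k)) mulr0 addr0 => ->.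
  have -> : 'X^2 * (p k * u) = p k * (p k + (y ^+ 2) *: u).
    by rewrite {3}pu -mul_polyC; ring.
  by rewrite mulrDr LD pp eqxx -scalerAr LZ (low u (ltnW su_k)) /=; ring.
have h2 : L ('X * (p k)^`() * u) = 2 * s.
  have -> : 'X * (p k)^`() * u = ('X * (p k * u))^`() - p k * ('X * u)^`().
    by rewrite !derivM; ring.
  rewrite LB h1 low ?subr0//.
  by apply: leq_trans (size_deriv_leq _) _; rewrite mulrC size_mulX.
have pu_odd : L ((p k)^`() * u) = 0.
  have := L_refl ((p k)^`() * u).
  suff -> : ((p k)^`() * u) \Po - 'X = - ((p k)^`() * u).
    by rewrite -scaleN1r LZ => ?; lra.
  have h := orthonormal_parity k op.
  have hu : u \Po - 'X = (-1) ^+ k *: u.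
    apply: (@mulIf _ ('X^2 - (y ^+ 2)%:P)).
      by rewrite -size_poly_eq0 size_XnsubC.
    rewrite -scalerAl -pu -h pu comp_polyM; congr (_ * _).
    by rewrite comp_polyB comp_polyC comp_Xn_poly sqrrN.
  have hp : (p k)^`() \Po - 'X = - ((-1) ^+ k *: (p k)^`()).
    by rewrite -derivZ -h deriv_comp derivN derivX mulrN1 opprK.
  rewrite comp_polyM hu hp mulNr -(@scalerAl _ {poly R}).
  rewrite -(@scalerAr _ {poly R}) scalerA -expr2.
  by rewrite sqrr_sign scale1r.
have h3 : L ((p k)^`() * q) = 2 * s.
  have -> : (p k)^`() * q = 'X * (p k)^`() * u + y *: ((p k)^`() * u).
    by rewrite qu -mul_polyC polyCN; ring.
  by rewrite LD LZ pu_odd h2 mulr0 addr0.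
have -> : q * q = (p k)^`() * q - p k * q^`().
  by rewrite pq derivM derivXsubC; ring.
rewrite LB h3 low ?subr0//.
by rewrite (leq_trans (size_deriv_leq _))// sq.
Qed.

(** With such a [v], the square of [v * ('X - y%:P)] equals [v * p k]; its integral vanishes because
    [v] has degree below [k], against positivity. *)
Lemma orthonormal_simple_root p k y v : orthonormal_for p ->
  p k <> v * ('X - y%:P) ^+ 2.
Proof.
move=> op pv; have [sp lp pp] := op.
have pk0 : p k != 0 by rewrite -size_poly_eq0 sp.
have sv : (size v <= k)%N.
  have v0 : v != 0 by apply: contraNneq pk0 => v0; rewrite pv v0 mul0r.
  have := sp k; rewrite pv expr2 mulrA.
  rewrite !size_Mmonic ?monicXsubC ?mulf_neq0 ?polyXsubC_eq0// !size_XsubC.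
  by rewrite !addn2 => -[<-].
have : L (v * ('X - y%:P) * (v * ('X - y%:P))) = 0.
  by rewrite -(orthonormal_low op sv) pv; congr L; ring.
move=> /L_sqr_eq0 h; move: pk0; rewrite pv expr2 mulrA h mul0r eqxx //.
Qed.

End orthonormal_family.

(** * Number and symmetry of the real zeros *)

Section real_roots.
Context {R : rcfType}.
Implicit Types (P Q : {poly R}).

Lemma noroot_sign P x y : (forall z, ~~ root P z) -> 0 < P.[x] * P.[y].
Proof.
move=> nr; rewrite ltNge; apply/negP => h.
wlog xy : x y h / x <= y.
  move=> W; have [xy|yx] := leP x y; first exact: (W x y).
  by apply: (W y x); rewrite ?(ltW yx)// mulrC.
by have [z _ /(negP (nr z))] := polyrcf.poly_ivt xy h.
Qed.

Variable L : {poly R} -> R.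
Hypothesis linL : linear_functional L.
Hypothesis L_pos : forall P, (forall x, 0 <= P.[x]) -> P != 0 -> 0 < L P.

Lemma mem_rootsR P z : P != 0 -> (z \in rootsR P) = root P z.
Proof. by move=> P0; rewrite -(roots_on_rootsR P0 z) in_itv. Qed.

(** Write [p k = g * r], where [r] collects one linear factor per real root. A root of [g] would be
    a double root of [p k], so [g] has constant sign and [g.[0] *: (p k * r)] is nonnegative and
    nonzero. Its integral is positive, which orthogonality forbids unless [r] has degree at least
    [k]. *)
Lemma size_rootsR_orthonormal p k : orthonormal_for L p -> size (rootsR (p k)) = k.
Proof.
move=> op; have [sp lp pp] := op.
have pk0 : p k != 0 by rewrite -size_poly_eq0 sp.
pose r := \prod_(z <- rootsR (p k)) ('X - z%:P).
have urs : poly.uniq_roots (rootsR (p k)) by rewrite uniq_rootsE polyrcf.uniq_roots.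
have ars : all (root (p k)) (rootsR (p k)).
  by apply/allP => z; rewrite mem_rootsR.
have [g pg] := uniq_roots_prod_XsubC ars urs.
have g0 : g != 0 by apply: contraNneq pk0 => g0; rewrite pg g0 mul0r.
have sr : size r = (size (rootsR (p k))).+1 by rewrite size_prod_XsubC.
have r0 : r != 0 by rewrite -size_poly_eq0 sr.
have gnr z : ~~ root g z.
  apply/negP => gz; have /factor_theorem[v gv] := gz.
  have : z \in rootsR (p k) by rewrite mem_rootsR// pg rootM gz.
  rewrite -root_prod_XsubC => /factor_theorem[w rw].
  apply: (orthonormal_simple_root (k := k) (y := z) (v := v * w) linL L_pos op).
  by rewrite pg rw gv; ring.
have le_k : (size r <= k.+1)%N.
  by rewrite -(sp k) pg; apply: dvdp_leq; rewrite ?mulf_neq0 ?dvdp_mulIr.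
have ge_k : (k < size r)%N.
  rewrite ltnNge; apply/negP => /(orthonormal_low linL op).
  have := L_pos (P := g.[0] *: (p k * r)).
  rewrite linear_functionalZ// => h /[dup] h0; move: h => /[swap] ->.
  rewrite mulr0 ltxx => h; suff : false by []; apply: h.
    move=> x; rewrite pg -/r hornerZ !hornerM.
    rewrite (_ : _ * _ = g.[0] * g.[x] * r.[x] ^+ 2); last by ring.
    by rewrite mulr_ge0 ?sqr_ge0// ltW// noroot_sign.
  rewrite scaler_eq0 mulf_eq0 (negbTE pk0) (negbTE r0) !orbF.
  exact: gnr.
by apply/eqP; rewrite eqn_leq; move: le_k ge_k; rewrite sr !ltnS => -> ->.
Qed.

(** A symmetric increasing list is the reversal of its negation, so the two middle entries are
    opposite; being increasing, they enclose 0. *)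
Lemma sorted_symmetric_middle (rs : seq R) m : sorted <%R rs ->
  (forall z, (- z \in rs) = (z \in rs)) -> size rs = m.*2 -> (0 < m)%N ->
  0 < nth 0 rs m /\ (forall z, z \in rs -> 0 < z -> nth 0 rs m <= z).
Proof.
move=> srs sym sz m0.
have rsE : rs = rev (map -%R rs).
  apply: (irr_sorted_eq lt_trans ltxx) => // [|z].
    rewrite rev_sorted sorted_map; apply: sub_sorted srs => x y /= xy.
    by rewrite ltrN2.
  by rewrite mem_rev -[z in RHS]opprK (mem_map oppr_inj) sym.
have ltn_nth i j : (i < j)%N -> (j < m.*2)%N -> nth 0 rs i < nth 0 rs j.
  move=> ij jm; apply: (sorted_ltn_nth lt_trans) => //; rewrite ?inE sz//.
  exact: ltn_trans jm.
have mid : nth 0 rs m.-1 = - nth 0 rs m.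
  rewrite {1}rsE nth_rev ?size_map ?sz; last by lia.
  rewrite (nth_map 0) ?sz; last by lia.
  by congr (- nth 0 rs _); lia.
have mm : nth 0 rs m.-1 < nth 0 rs m by apply: ltn_nth; lia.
split=> [|z zrs z0]; first by lra.
rewrite -(nth_index 0 zrs); have [im|] := leqP m (index z rs).
  move: im; rewrite leq_eqVlt => /predU1P[<-//|im]; apply/ltW/ltn_nth => //.
  by rewrite -sz index_mem.
move=> im; have : nth 0 rs (index z rs) <= nth 0 rs m.-1.
  have : (index z rs <= m.-1)%N by lia.
  rewrite leq_eqVlt => /predU1P[->//|im']; apply/ltW/ltn_nth => //; lia.
rewrite nth_index//; lra.
Qed.

Hypothesis L_refl : forall P, L (P \Po - 'X) = L P.

Lemma orthonormal_middle_root p k (m := (k %/ 2)%N) : orthonormal_for L p ->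
  ~~ odd k -> (0 < k)%N ->
  0 < nth 0 (rev (rootsR (p k))) m.-1 /\
  (forall z, root (p k) z -> 0 < z -> nth 0 (rev (rootsR (p k))) m.-1 <= z).
Proof.
move=> op ek k0; have sz := size_rootsR_orthonormal k op.
have [sp _ _] := op.
have pk0 : p k != 0 by rewrite -size_poly_eq0 sp.
have km : k = m.*2 by rewrite /m divn2 even_halfK.
have m0 : (0 < m)%N by rewrite -double_gt0 -km.
(* Among [m.*2] roots, position [m.-1] from the top is position [m] from the bottom, both counted
   from 0. *)
have -> : nth 0 (rev (rootsR (p k))) m.-1 = nth 0 (rootsR (p k)) m.
  by rewrite nth_rev sz; [congr nth|]; lia.
have [|z|||pos minz] := @sorted_symmetric_middle (rootsR (p k)) m.
- exact: sorted_roots.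
- rewrite !mem_rootsR//; apply/idP/idP => /(root_oppX linL L_refl op)//.
  by rewrite opprK.
- by rewrite sz km.
- by [].
by split=> // z rz z0; apply: minz; rewrite ?mem_rootsR.
Qed.

End real_roots.

(** * The generalized Hermite functional *)

Section integration.
Context {R : realType}.
Notation mu := (@lebesgue_measure R).
Implicit Types (f F : R -> R).

Lemma is_derive_continuous F (x df : R) :
  is_derive x (1:R) F df -> {for x, continuous F}.
Proof.
by move=> ?; apply/differentiable_continuous/derivable1_diffP; exact: ex_derive.
Qed.

Lemma integral_is_derive f F (a b : R) : a < b ->
  (forall x : R, a <= x <= b -> is_derive x (1:R) F (f x)) ->
  (forall x : R, a <= x <= b -> {for x, continuous f}) ->
  (\int[mu]_(x in `[a, b]) (f x)%:E = (F b - F a)%:E)%E.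
Proof.
move=> ab dF cf; rewrite (@continuous_FTC2 _ f F)//.
- by apply: continuous_in_subspaceT => x; rewrite inE/= in_itv/=; exact: cf.
- split => [x||].
  + by rewrite in_itv/= => /andP[ax xb]; apply: ex_derive; apply: dF; rewrite !ltW.
  + by apply: cvg_at_right_filter; apply/is_derive_continuous/dF; rewrite lexx ltW.
  + by apply: cvg_at_left_filter; apply/is_derive_continuous/dF; rewrite lexx ltW.
- move=> x; rewrite in_itv/= => /andP[ax xb].
  by rewrite derive1E; apply: derive_val; apply: dF; rewrite !ltW.
Qed.

(** Exhaust the half-line by compact intervals: the fundamental theorem evaluates each integral, the
    boundary terms tend to 0, and dominated convergence with majorant [|f|] passes to the limit. *)
Lemma integral_is_derive_gt0 f F :
  mu.-integrable `]0, +oo[ (EFin \o f) ->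
  (forall x : R, 0 < x -> is_derive x (1:R) F (f x)) ->
  (forall x : R, 0 < x -> {for x, continuous f}) ->
  F x @[x --> 0^'+] --> 0 -> F x @[x --> +oo] --> 0 ->
  (\int[mu]_(x in `]0%R, +oo[) (f x)%:E = 0)%E.
Proof.
move=> intf dF cf F0 Foo.
(* The right end is [n.+2] so that the interval is nondegenerate already at [n = 0]. *)
pose A n := `[n.+1%:R^-1, n.+2%:R]%classic : set R.
pose fn n x := (f \_ (A n)) x.
have An n : A n `<=` `]0, +oo[.
  move=> x; rewrite /A /= !in_itv/= andbT => /andP[+ _].
  by apply: lt_le_trans; rewrite invr_gt0.
have mA n : measurable (A n) by exact: measurable_itv.
have mf : measurable_fun (`]0%R, +oo[%classic : set R) f.
  by have /integrableP[/measurable_EFinP] := intf.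
have [n|||||_ _ cvgf] := @dominated_convergence _ (measurableTypeR R) R mu
    `]0%R, +oo[ (measurable_itv _) (fun n x => (fn n x)%:E) (EFin \o f)
    (fun x => `|(f x)%:E|%E).
- apply/measurable_EFinP/measurable_restrict => //; first exact: mA.
  by apply: measurable_funS mf => //; exact: subIsetl.
- exact/measurable_EFinP.
- apply: aeW => x; rewrite /= in_itv/= andbT => x0.
  apply: cvg_near_cst; rewrite /=.
  have [N _ hN] : \forall n \near \oo, x^-1 <= n%:R :> R /\ x <= n%:R :> R.
    by near=> n; split; near: n; exact: nbhs_infty_ger.
  exists N => // n /= Nn; rewrite /fn patchE mem_set// /A /= in_itv/=.
  have [h1 h2] := hN _ Nn; apply/andP; split.
    rewrite -[leRHS]invrK lef_pV2 ?posrE ?invr_gt0//.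
    by rewrite (le_trans h1)// ler_nat.
  by rewrite (le_trans h2)// ler_nat ltnW.
- by apply: integrable_abse.
- apply: aeW => x n _; rewrite /fn patchE; case: ifPn => _ //.
  by rewrite abse0 abse_ge0.
have := cvgf.
suff /cvg_lim h : [sequence (\int[mu]_(x in `]0%R, +oo[) (fn n x)%:E)%E]_n @ \oo --> 0%E.
  by move=> /cvg_lim <-//; rewrite h.
have -> : [sequence (\int[mu]_(x in `]0%R, +oo[) (fn n x)%:E)%E]_n =
    (fun n => (F n.+2%:R - F n.+1%:R^-1)%:E).
  apply/funext => n; rewrite /= /fn.
  transitivity (\int[mu]_(x in `]0%R, +oo[) ((EFin \o f) \_ (A n)) x)%E.
    by rewrite restrict_EFin.
  rewrite -integral_mkcondr setIidr//.
  apply: integral_is_derive => [|x /andP[nx _]|x /andP[nx _]].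
  - by rewrite (@le_lt_trans _ _ 1)// ?invf_le1 ?ler1n// ltr1n.
  - by apply: dF; rewrite (lt_le_trans _ nx)// invr_gt0.
  - by apply: cf; rewrite (lt_le_trans _ nx)// invr_gt0.
apply: cvg_EFin; first exact: nearW.
rewrite -[0]subr0; apply: cvgB.
  move/cvg_pinftyP : Foo; apply.
  apply/cvgryPge => r; near=> n.
  rewrite (@le_trans _ _ n%:R)// ?ler_nat ?leqW//.
  by near: n; exact: nbhs_infty_ger.
by move/cvg_at_rightP : F0; apply; split=> [n|]; [rewrite invr_gt0|exact: cvg_harmonic].
Unshelve. all: by end_near. Qed.

(** Lebesgue measure is its own pushforward under negation. *)
Lemma Rintegral_opp f : mu.-integrable setT (EFin \o f) ->
  mu.-integrable setT (EFin \o (f \o -%R)) /\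
  \int[mu]_x (f (- x)) = \int[mu]_x f x.
Proof.
move=> intf; have /integrableP[mf foo] := intf.
have mopp : measurable_fun [set: measurableTypeR R] (-%R : _ -> measurableTypeR R).
  exact: oppr_measurable.
have mfN : measurable_fun setT ((EFin \o f) \o (-%R : _ -> measurableTypeR R)).
  exact: measurableT_comp.
have pushE (g : measurableTypeR R -> \bar R) :
  (\int[pushforward mu (-%R : _ -> measurableTypeR R)]_x g x = \int[mu]_x g x)%E.
  by apply: eq_measure_integral => A mA _; exact: lebesgue_measureN.
have intfN : mu.-integrable setT ((EFin \o f) \o (-%R : _ -> measurableTypeR R)).
  apply/integrableP; split => //.
  have := ge0_integral_pushforward mopp mu (D := setT)
    (f := fun x => `|(f x)%:E|%E).
  rewrite preimage_setT pushE => <- //; exact: measurableT_comp.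
split=> //; rewrite /Rintegral; congr fine.
have := integral_pushforward mopp (D := setT) (mu := mu) mf.
rewrite preimage_setT pushE => -> //.
Qed.

End integration.

(** * Derivative, decay and boundary behaviour of the weight *)

Section weight.
Context {R : realType} (s sigma : R).
Hypotheses (hs : 0 < s) (hsigma : - (1 / 2) < sigma).
Notation mu := (@lebesgue_measure R).
Notation w := (weight s sigma).
Implicit Types (P Q : {poly R}).

Lemma weight_ge0 x : 0 <= w x.
Proof. by rewrite mulr_ge0 ?powR_ge0 ?expR_ge0. Qed.

Lemma weight_gt0 x : x != 0 -> 0 < w x.
Proof. by move=> x0; apply: mulr_gt0; rewrite ?expR_gt0// powR_gt0 ?normr_gt0. Qed.

Lemma weightN x : w (- x) = w x.
Proof. by rewrite /weight normrN sqrrN. Qed.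

Lemma measurable_weight : measurable_fun setT w.
Proof.
apply: measurable_funM.
  exact: (measurableT_comp (measurable_powR _) (@normr_measurable R setT)).
apply: (measurableT_comp (@measurable_expR R)).
apply: (measurableT_comp (@oppr_measurable R setT)).
by apply: measurable_funM => //; exact: exprn_measurable.
Qed.

Lemma is_derive_weight (x : R) : 0 < x ->
  is_derive x (1:R) w ((2 * sigma / x - 2 * s * x) * w x).
Proof.
move=> x0.
apply: (@near_eq_is_derive _ _ _ (fun x => x `^ (2 * sigma) * expR (- (s * x ^+ 2)))).
  by near=> y; rewrite /weight gtr0_norm//; near: y; exact: lt_nbhsr.
have dp := is_derive1_powR (2 * sigma) x0.
have dq : is_derive x (1:R) (fun x => - (s * x ^+ 2)) (- (2 * s * x)).
  by apply: is_derive_eq; rewrite /GRing.scale /=; ring.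
have de := is_derive1_comp (is_derive_expR _) dq.
apply: is_derive_eq (is_deriveM dp de) _.
rewrite /weight gtr0_norm// /GRing.scale /=.
rewrite powRB; last by rewrite (gt_eqF x0) implybT.
by rewrite powRr1 ?ltW//; ring.
Unshelve. end_near. Qed.

Lemma is_derive_weighted P (x : R) : 0 < x -> is_derive x (1:R)
  (fun y => y * P.[y] * w y)
  ((('X * P)^`() + (2 * sigma) *: P - (2 * s) *: ('X^2 * P)).[x] * w x).
Proof.
move=> x0; have dw := is_derive_weight x0.
apply: is_derive_eq.
move: (w x) => wx; rewrite /GRing.scale /= derivM derivX !hornerE /=; field.
by rewrite gt_eqF.
Qed.

(** The bound [expR u >= u ^ N / N!] at [u = s x ^ 2] beats the power [N], which exceeds by one what
    [P] and the factor [|x| ^ (2 sigma)] need; the spare power gives the division by [|x|]. *)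
Lemma weight_decay P :
  exists C, forall x, 1 <= `|x| -> `|P.[x] * w x| <= C / `|x|.
Proof.
pose m := `|Num.ceil (2 * sigma)|%N.
pose N := (size P + m).+1.
exists ((\sum_(i < size P) `|P`_i|) * (N`!%:R / s ^+ N)) => x x1.
have x0 : 0 < `|x| by exact: lt_le_trans x1.
have hP : `|P.[x]| <= (\sum_(i < size P) `|P`_i|) * `|x| ^+ size P.
  rewrite horner_coef (le_trans (ler_norm_sum _ _ _))// mulr_suml ler_sum// => i _.
  by rewrite normrM normrX ler_wpM2l// ler_weXn2l// ltnW.
have hw : `|x| `^ (2 * sigma) <= `|x| ^+ m.
  rewrite -powR_mulrn ?normr_ge0// ler_powR// /m.
  rewrite -[leRHS]/((Posz `|Num.ceil (2 * sigma)|%N)%:~R) abszE.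
  by rewrite (le_trans (ceil_ge _))// ler_int ler_norm.
have he : `|x| ^+ N * expR (- (s * x ^+ 2)) <= N`!%:R / s ^+ N.
  have sx0 : 0 < s * x ^+ 2 by rewrite mulr_gt0// exprn_even_gt0 -?normr_gt0.
  have := expR_ge1Dxn (size P + m) (ltW sx0).
  rewrite expRN -/N => h.
  rewrite ler_pdivrMr ?expR_gt0//.
  have : (s * x ^+ 2) ^+ N / N`!%:R <= expR (s * x ^+ 2).
    by apply: le_trans h; rewrite lerDr.
  rewrite ler_pdivrMr ?ltr0n ?fact_gt0// exprMn => h'.
  rewrite mulrAC ler_pdivlMr ?exprn_gt0//.
  rewrite mulrC [leRHS]mulrC; apply: le_trans h'.
  apply: ler_wpM2l; first by rewrite exprn_ge0// ltW.
  have -> : x ^+ 2 = `|x| ^+ 2 by rewrite real_normK// num_real.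
  by rewrite -exprM ler_weXn2l// leq_pmull.
rewrite ler_pdivlMr// normrM (ger0_norm (weight_ge0 _)) -!mulrA.
apply: le_trans (ler_wpM2r _ hP) _; first by rewrite mulr_ge0// weight_ge0.
rewrite -mulrA ler_wpM2l ?sumr_ge0//.
apply: le_trans he; rewrite /weight.
have -> : `|x| ^+ N = `|x| ^+ m * (`|x| ^+ size P * `|x|).
  by rewrite /N exprS exprD; ring.
rewrite [leLHS](_ : _ = `|x| `^ (2 * sigma) *
  (`|x| ^+ size P * `|x| * expR (- (s * x ^+ 2)))); last by ring.
apply: le_trans (ler_wpM2r _ hw) _; first by rewrite !mulr_ge0 ?expR_ge0.
by rewrite le_eqVlt; apply/orP; left; apply/eqP; ring.
Qed.

Lemma measurable_weighted P : measurable_fun setT (fun x => P.[x] * w x).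
Proof. by apply: measurable_funM; [exact: measurable_poly|exact: measurable_weight]. Qed.

(** The factor [x] raises the exponent of the weight to [1 + 2 sigma], positive by [hsigma]. *)
Lemma weighted_cvg0 P : x * P.[x] * w x @[x --> 0^'+] --> 0.
Proof.
have a0 : 0 < 1 + 2 * sigma by move: hsigma; lra.
have c1 : P.[x] * expR (- (s * x ^+ 2)) @[x --> 0^'+] -->
    P.[0] * expR (- (s * 0 ^+ 2)).
  apply: cvg_at_right_filter; apply: cvgM; first exact: continuous_horner.
  apply: continuous_comp; last exact: continuous_expR.
  by apply: cvgN; apply: cvgM; [exact: cvg_cst|exact: exprn_continuous].
apply: (@cvg_trans _ (P.[x] * expR (- (s * x ^+ 2)) * x `^ (1 + 2 * sigma)
    @[x --> 0^'+])); last first.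
  by have := cvgM c1 (powR_cvg0 a0); rewrite mulr0; exact.
apply: near_eq_cvg; near=> x.
have x0 : 0 < x by near: x; exact: nbhs_right_gt.
rewrite /weight gtr0_norm// powRD ?(gt_eqF x0) ?implybT// powRr1 ?ltW//=.
ring.
Unshelve. all: by end_near. Qed.

Lemma weighted_cvgy P : P.[x] * w x @[x --> +oo] --> 0.
Proof.
have [C hC] := weight_decay P.
apply/cvgr0Pnorm_le => e e0; near=> x.
have x1 : 1 <= x by near: x; exact: nbhs_pinfty_ge.
have x0 : 0 < x by exact: lt_le_trans x1.
have := hC x; rewrite (gtr0_norm x0) => /(_ x1) /le_trans; apply.
rewrite ler_pdivrMr // -ler_pdivrMl //.
Unshelve. all: by end_near. Qed.

End weight.

(** * The weighted integral satisfies the abstract hypotheses on [L] *)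

Section functional.
Context {R : realType} (s sigma : R) (p : nat -> {poly R}).
Hypotheses (hs : 0 < s) (hsigma : - (1 / 2) < sigma).
Hypothesis op : orthonormal_polys s sigma p.
Notation mu := (@lebesgue_measure R).
Notation w := (weight s sigma).
Implicit Types (P Q : {poly R}).

Let integrable_sqr k :
  mu.-integrable setT (EFin \o (fun x => (p k * p k).[x] * w x)).
Proof.
have [_ _ pp] := op; apply/integrableP; split.
  by apply/measurable_EFinP; exact: measurable_weighted.
under eq_integral => x _ do
  rewrite /= ger0_norm ?mulr_ge0 ?weight_ge0 ?hornerM -?expr2 ?sqr_ge0//.
under eq_integral => x _ do rewrite expr2.
by rewrite pp ltry.
Qed.

Let integrable_prod j k :
  mu.-integrable setT (EFin \o (fun x => (p j * p k).[x] * w x)).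
Proof.
apply: (le_integrable _ _ _ (integrableD _ (integrable_sqr j) (integrable_sqr k))) => //.
  by apply/measurable_EFinP; exact: measurable_weighted.
move=> x _; rewrite /= lee_fin -mulrDl !normrM.
rewrite ler_wpM2r// !hornerM -!expr2 normrM.
rewrite [leRHS]ger0_norm ?addr_ge0 ?sqr_ge0//.
rewrite -[X in _ <= X + _]real_normK ?num_real// -[X in _ <= _ + X]real_normK ?num_real//.
by have := sqr_ge0 (`|(p j).[x]| - `|(p k).[x]|); nra.
Qed.

(* Integrability is read off the normalization of the [p k]: it gives that of
   [p 0 * p j * w], where [p 0] is a nonzero constant and the [p j] span. *)
Lemma integrable_weighted P : mu.-integrable setT (EFin \o (fun x => P.[x] * w x)).
Proof.
have [sp lp _] := op.
have [c ->] := poly_span sp (leqnn (size P)).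
rewrite (_ : _ \o _ = fun x => (\sum_(j < size P)
  (c j / (p 0)`_0)%:E * ((p 0 * p j).[x] * w x)%:E)%E).
  by apply: integrable_sum => // j _; exact: (integrableZl measurableT _ (integrable_prod 0 j)).
apply/funext => x; rewrite /= horner_sum mulr_suml -sumEFin.
apply: eq_bigr => j _; rewrite -EFinM; congr EFin.
have p00 : (p 0)`_0 != 0.
  by have := lp 0%N; rewrite lead_coefE sp => /lt0r_neq0.
rewrite hornerM (size1_polyC (p := p 0)) ?sp// hornerC hornerZ coefC /=; field.
by [].
Qed.

Definition weighted_integral P := \int[mu]_x (P.[x] * w x).
Local Notation L := weighted_integral.

Lemma weighted_integral_linear : linear_functional L.
Proof.
move=> a P Q.
have aE : (fun x => a * (P.[x] * w x)) = (fun x => (a *: P).[x] * w x).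
  by apply/funext => x; rewrite hornerZ mulrA.
rewrite /weighted_integral -RintegralZl//; last exact: integrable_weighted.
rewrite -RintegralD ?aE//; try exact: integrable_weighted.
by apply: eq_Rintegral => x _; rewrite hornerD ?hornerZ; ring.
Qed.

Lemma weighted_integral_orthonormal : orthonormal_for L p.
Proof.
have [sp lp pp] := op; split => // k l.
by rewrite /weighted_integral /Rintegral; under eq_integral do rewrite hornerM;
  rewrite pp.
Qed.

Lemma weighted_integral_refl P : L (P \Po - 'X) = L P.
Proof.
have [_ h] := Rintegral_opp (integrable_weighted P).
rewrite /weighted_integral -h.
apply: eq_Rintegral => x _.
by rewrite weightN horner_comp hornerN hornerX.
Qed.

(** Pick [a > 0] with [P.[a] != 0]. The weight is continuous and positive there, so the integrand
    stays above half its value at [a] on an interval around [a]. *)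
Lemma weighted_integral_gt0 P : (forall x, 0 <= P.[x]) -> P != 0 -> 0 < L P.
Proof.
move=> P0 Pneq0.
have [a a0 Pa] := poly_neq0_gt 0 Pneq0.
pose f x := P.[x] * w x.
have fa : 0 < f a by rewrite mulr_gt0 ?weight_gt0 ?gt_eqF// lt_neqAle eq_sym Pa P0.
have cf : {for a, continuous f}.
  apply: continuousM; first exact: continuous_horner.
  exact: is_derive_continuous (is_derive_weight _ _ a0).
have fge0 x : 0 <= f x by rewrite mulr_ge0 ?weight_ge0.
have [e /= e0 he] : \forall y \near a, f a / 2 <= f y.
  by apply: (cvgr_ge _ cf); lra.
pose I := `[(a - e / 2), (a + e / 2)]%classic : set R.
have : \int[mu]_(x in I) (f a / 2) <= \int[mu]_x f x.
  rewrite [leLHS]Rintegral_mkcond; apply: (le_Rintegral (mu := mu)) => //.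
  - rewrite -restrict_EFin; apply: (@integrable_mkcond _ (measurableTypeR R) R
      mu I (EFin \o cst (f a / 2)) (measurable_itv _)).1.
    apply: continuous_compact_integrable; first exact: segment_compact.
    by move=> x; exact: cvg_cst.
  - exact: integrable_weighted.
  - move=> x _; rewrite patchE; case: ifPn => //; rewrite inE /I/= in_itv/= => xI.
    by apply: he; rewrite /ball_ /= ltr_distlC; lra.
apply: lt_le_trans; rewrite Rintegral_cst//; last exact: measurable_itv.
rewrite [X in fine X](_ : _ = e%:E); first by rewrite /= mulr_gt0 ?divr_gt0.
apply: etrans (lebesgue_measure_itv _) _; rewrite /= lte_fin ifT; last by lra.
by rewrite -EFinD; congr EFin; lra.
Qed.

Let half_line P :
  (\int[mu]_(x in `]0%R, +oo[)
    ((('X * P)^`() + (2 * sigma) *: P - (2 * s) *: ('X^2 * P)).[x] * w x)%:E = 0)%E.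
Proof.
apply: (@integral_is_derive_gt0 _ _ (fun y => y * P.[y] * w y)).
- exact: integrableS (integrable_weighted _).
- by move=> x x0; exact: is_derive_weighted.
- move=> x x0; apply: continuousM; first exact: continuous_horner.
  exact: is_derive_continuous (is_derive_weight _ _ x0).
- exact: weighted_cvg0.
- have := weighted_cvgy sigma hs ('X * P).
  by under eq_fun do rewrite hornerM hornerX.
Qed.

(** Split the line at 0. Reflection carries the negative half to the positive one and turns the
    integrand for [P] into the one for [P \Po - 'X], so [half_line] settles both halves. *)
Lemma weighted_integral_parts P :
  L ('X * P)^`() + 2 * sigma * L P = 2 * s * L ('X^2 * P).
Proof.
have lin := weighted_integral_linear.
apply/eqP; rewrite -subr_eq0 -!(linear_functionalZ _ _ lin).
rewrite -(linear_functionalD _ _ lin) -(linear_functionalB _ _ lin).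
set G := _ - _; have iG := integrable_weighted G.
apply/eqP; rewrite /weighted_integral.
pose I := `]0, +oo[%classic : set R; pose J := `[0, +oo[%classic : set R.
have mI : measurable I by exact: measurable_itv.
have mJ : measurable J by exact: measurable_itv.
have IJ x : (x \in ~` I) = (- x \in J).
  apply/idP/idP; rewrite !inE /I /J /= !in_itv/= !andbT oppr_ge0.
    by move=> /negP; rewrite -leNgt.
  by move=> x0; apply/negP; rewrite -leNgt.
rewrite -(setUv I) Rintegral_setU ?setUv//; last 2 first.
- exact: measurableC.
- exact/disj_setPCl.
rewrite [X in X + _]/Rintegral half_line /= add0r Rintegral_mkcond.
have iF : mu.-integrable setT (EFin \o ((fun x => G.[x] * w x) \_ (~` I))).
  rewrite -restrict_EFin; apply: (@integrable_mkcond _ (measurableTypeR R) R mu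
    (~` I) (EFin \o (fun x => G.[x] * w x)) _).1; first exact: measurableC.
  by apply: integrableS iG => //; exact: measurableC.
have [_ <-] := Rintegral_opp iF.
pose P' := P \Po - 'X.
pose G' := ('X * P')^`() + (2 * sigma) *: P' - (2 * s) *: ('X^2 * P').
have GE x : G.[- x] = G'.[x].
  rewrite /G /G' /P' !derivM deriv_comp derivN derivX.
  by rewrite !(hornerD, hornerN, hornerZ, hornerM, hornerX, hornerXn, hornerC,
    horner_comp); ring.
transitivity (\int[mu]_(x in J) (G'.[x] * w x)).
  rewrite [RHS]Rintegral_mkcond; apply: eq_Rintegral => x _.
  by rewrite !patchE IJ opprK weightN GE.
rewrite /J -Rintegral_itv_obnd_cbnd; last exact: integrableS (integrable_weighted _).
by rewrite /Rintegral half_line.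
Qed.

End functional.

(** * Sturm comparison and Landau's inequality *)

Section real_functions.
Context {R : realType}.
Implicit Types (f Q : R -> R) (a b : R).

Lemma is_derive_neq0_gt0 f (f1 : R -> R) a b :
  (forall x : R, a <= x <= b -> is_derive x (1:R) f (f1 x)) ->
  (forall x, a <= x <= b -> f x != 0) ->
  forall x, a <= x <= b -> 0 < f a -> 0 < f x.
Proof.
move=> df fn0 x /andP[ax xb] fa; rewrite ltNge; apply/negP => fx.
have cf : {within `[a, x], continuous f}.
  apply: continuous_in_subspaceT => z; rewrite inE/= in_itv/= => /andP[az zx].
  by apply: is_derive_continuous (df z _); rewrite az (le_trans zx).
have [|c] := IVT ax cf (v := 0).
  by rewrite ge_min fx orbT le_max (ltW fa).
rewrite in_itv/= => /andP[ac cx] /eqP; apply/negP; apply: fn0.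
by rewrite ac (le_trans cx).
Qed.

(* The Wronskian of [f] and [sin (kappa (x - a))] is nonincreasing where [f > 0]. *)
Lemma sturm_sin_pos f (f1 : R -> R) Q a kappa (b := a + pi / kappa) : 0 < kappa ->
  (forall x : R, a <= x <= b -> is_derive x (1:R) f (f1 x)) ->
  (forall x : R, a <= x <= b -> is_derive x (1:R) f1 (- (Q x * f x))) ->
  (forall x, a <= x <= b -> kappa ^+ 2 <= Q x) ->
  ~ (forall x, a <= x <= b -> 0 < f x).
Proof.
move=> k0 df df1 hQ f0.
have pk0 : 0 < pi / kappa by rewrite divr_gt0// pi_gt0.
have ab : a <= b by rewrite /b lerDl ltW.
pose u x := kappa * (x - a).
pose W x := f1 x * sin (u x) - kappa * f x * cos (u x).
have dW x : a <= x <= b ->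
    is_derive x (1:R) W ((kappa ^+ 2 - Q x) * f x * sin (u x)).
  move=> axb; have d0 := df x axb; have d1 := df1 x axb.
  have du : is_derive x (1:R) u kappa.
    by apply: is_derive_eq; rewrite /GRing.scale /=; ring.
  have ds := is_derive1_comp (is_derive_sin (u x)) du.
  have dc := is_derive1_comp (is_derive_cos (u x)) du.
  have dk : is_derive x (1:R) (fun x => kappa * f x) (kappa * f1 x).
    by apply: is_derive_eq; rewrite /GRing.scale /=; ring.
  apply: is_derive_eq (is_deriveB (is_deriveM d1 ds) (is_deriveM dk dc)) _.
  by rewrite /GRing.scale /=; ring.
have : W b <= W a.
  apply: (@ler0_derive1_le_cc _ W a b) => //; rewrite ?in_itv/= ?lexx ?ab//.
  - move=> x; rewrite in_itv/= => /andP[ax xb].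
    by apply: ex_derive; apply: dW; rewrite !ltW.
  - move=> x; rewrite in_itv/= => /andP[ax xb].
    have axb : a <= x <= b by rewrite !ltW.
    have dWx := dW x axb; rewrite derive1E derive_val.
    apply: mulr_le0_ge0; last first.
      apply: sin_ge0_pi; apply/andP; split.
        by rewrite mulr_ge0 ?subr_ge0// ltW.
      by rewrite /u mulrC -ler_pdivlMr// lerBlDl ltW.
    apply: mulr_le0_ge0; first by rewrite subr_le0 hQ.
    exact/ltW/f0.
  - apply: continuous_in_subspaceT => x; rewrite inE/= in_itv/= => axb.
    exact: is_derive_continuous (dW x axb).
(* At the ends the sine vanishes and the cosine is 1, then -1, so [W a < 0 < W b], contradicting
   monotonicity. *)
have ua : u a = 0 by rewrite /u subrr mulr0.
have ub : u b = pi by rewrite /u /b addrC addKr mulrCA divff ?mulr1 ?gt_eqF.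
rewrite /W ua ub sin0 cos0 sinpi cospi; apply/negP; rewrite -ltNge.
have fa : 0 < f a by apply: f0; rewrite lexx.
have fb : 0 < f b by apply: f0; rewrite lexx ab.
nra.
Qed.

Lemma sturm_sin f (f1 : R -> R) Q a kappa (b := a + pi / kappa) : 0 < kappa ->
  (forall x : R, a <= x <= b -> is_derive x (1:R) f (f1 x)) ->
  (forall x : R, a <= x <= b -> is_derive x (1:R) f1 (- (Q x * f x))) ->
  (forall x, a <= x <= b -> kappa ^+ 2 <= Q x) ->
  exists2 z, a <= z <= b & f z = 0.
Proof.
move=> k0 df df1 hQ; apply: contrapT => nz.
have ab : a <= b by rewrite /b lerDl ltW// divr_gt0// pi_gt0.
have aab : a <= a <= b by rewrite lexx.
have fn0 x : a <= x <= b -> f x != 0.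
  by move=> axb; apply/eqP => fx; apply: nz; exists x.
have [fa|fa|/eqP] := ltgtP (f a) 0; last by rewrite (negbTE (fn0 _ aab)).
- have dN x : a <= x <= b -> is_derive x (1:R) (fun x => - f x) (- f1 x).
    by move=> /df dx; exact: is_deriveN.
  have dN1 x : a <= x <= b ->
      is_derive x (1:R) (fun x => - f1 x) (- (Q x * - f x)).
    move=> /df1 dx; apply: is_derive_eq (is_deriveN dx) _; ring.
  apply: (sturm_sin_pos k0 dN dN1 hQ) => x axb.
  apply: (is_derive_neq0_gt0 dN _ axb); last by rewrite oppr_gt0.
  by move=> z /fn0; rewrite oppr_eq0.
- apply: (sturm_sin_pos k0 df df1 hQ) => x axb.
  exact: (is_derive_neq0_gt0 df fn0 axb).
Qed.

Lemma derive_le_dist f (f1 : R -> R) a b K :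
  (forall x : R, a <= x <= b -> is_derive x (1:R) f (f1 x)) ->
  (forall x, a <= x <= b -> `|f1 x| <= K) ->
  forall x y, a <= x <= b -> a <= y <= b -> `|f x - f y| <= K * `|x - y|.
Proof.
move=> df hK x y.
wlog xy : x y / y <= x => [W|/andP[ax xb] /andP[ay yb]].
  have [yx|/ltW xy] := leP y x; first exact: W.
  by move=> hx hy; rewrite distrC [`|x - y|]distrC; exact: W.
have [||c] := @MVT_segment _ f f1 y x xy.
- move=> z; rewrite in_itv/= => /andP[yz zx]; apply: df.
  by rewrite (le_trans ay) ?(le_trans _ xb)// ltW.
- apply: continuous_in_subspaceT => z; rewrite inE/= in_itv/= => /andP[yz zx].
  by apply: is_derive_continuous (df z _); rewrite (le_trans ay)// (le_trans zx).
rewrite in_itv/= => /andP[yc cx] ->; rewrite normrM ler_wpM2r// hK//.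
by rewrite (le_trans ay)// (le_trans cx).
Qed.

(* Landau's inequality: the difference quotient over the whole interval gives
   one point where [f1] is small. *)
Lemma derive_le_landau f (f1 f2 : R -> R) a b m B : a < b ->
  (forall x : R, a <= x <= b -> is_derive x (1:R) f (f1 x)) ->
  (forall x : R, a <= x <= b -> is_derive x (1:R) f1 (f2 x)) ->
  (forall x, a <= x <= b -> `|f x| <= m) ->
  (forall x, a <= x <= b -> `|f2 x| <= B) ->
  forall x, a <= x <= b -> `|f1 x| <= 2 * m / (b - a) + B * (b - a).
Proof.
move=> ab df df1 hm hB x axb.
have ba0 : 0 < b - a by rewrite subr_gt0.
have aab : a <= a <= b by rewrite lexx ltW.
have bab : a <= b <= b by rewrite lexx ltW.
have [||c] := @MVT_segment _ f f1 a b (ltW ab).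
- by move=> z; rewrite in_itv/= => /andP[yz zx]; apply: df; rewrite !ltW.
- apply: continuous_in_subspaceT => z; rewrite inE/= in_itv/= => azb.
  exact: is_derive_continuous (df z azb).
rewrite in_itv/= => acb e.
have h1 : `|f1 c| <= 2 * m / (b - a).
  rewrite ler_pdivlMr// -[X in _ * X](gtr0_norm ba0) -normrM -e.
  by rewrite (le_trans (ler_normB _ _))// mulr_natl mulr2n lerD// hm.
have h2 := derive_le_dist df1 hB axb acb.
have h3 : `|x - c| <= b - a by rewrite ler_distlC; lra.
have B0 : 0 <= B by apply: le_trans (hB a aab).
have h4 : B * `|x - c| <= B * (b - a) by rewrite ler_wpM2l.
have := ler_normD (f1 c) (f1 x - f1 c); rewrite addrC subrK; lra.
Qed.

End real_functions.

(** * The orthonormal functions *)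

Section orthonormal_functions.
Context {R : realType} (s sigma : R) (p : nat -> {poly R}).
Hypotheses (hs : 0 < s) (hsigma : - (1 / 2) < sigma).
Hypothesis op : orthonormal_polys s sigma p.
Notation mu := (@lebesgue_measure R).
Notation w := (weight s sigma).
Local Notation L := (weighted_integral s sigma).
Implicit Types (P Q : {poly R}).

Let linL : linear_functional L := weighted_integral_linear op.
Let opL : orthonormal_for L p := weighted_integral_orthonormal op.
Let L_refl := weighted_integral_refl op.
Let L_parts := weighted_integral_parts hs hsigma op.
Let L_pos := weighted_integral_gt0 op.

Definition amplitude x := `|x| `^ sigma * expR (- (s * x ^+ 2) / 2).

Lemma amplitude_sqr x : amplitude x ^+ 2 = w x.
Proof.
rewrite /amplitude /weight exprMn -[_ `^ sigma ^+ 2]powR_mulrn ?powR_ge0//.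
rewrite -powRrM -expRM_natl [sigma * _]mulrC.
by have -> : 2%:R * (- (s * x ^+ 2) / 2) = - (s * x ^+ 2) by field.
Qed.

Lemma is_derive_amplitude (x : R) : 0 < x ->
  is_derive x (1:R) amplitude ((sigma / x - s * x) * amplitude x).
Proof.
move=> x0.
apply: (@near_eq_is_derive _ _ _
    (fun x => x `^ sigma * expR (- (s * x ^+ 2) / 2))).
  by near=> y; rewrite /amplitude gtr0_norm//; near: y; exact: lt_nbhsr.
have dp := is_derive1_powR sigma x0.
have dq : is_derive x (1:R) (fun x => - (s * x ^+ 2) / 2) (- (s * x)).
  by apply: is_derive_eq; rewrite /GRing.scale /=; field.
have de := is_derive1_comp (is_derive_expR _) dq.
apply: is_derive_eq (is_deriveM dp de) _.
rewrite /amplitude gtr0_norm// /GRing.scale /=.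
rewrite powRB; last by rewrite (gt_eqF x0) implybT.
by rewrite powRr1 ?ltW//; ring.
Unshelve. end_near. Qed.

Lemma xiE k : xi s sigma p k = fun x => amplitude x * (p k).[x].
Proof. by apply/funext => x; rewrite /xi /amplitude mulrAC. Qed.

Lemma xi_sqr k x : xi s sigma p k x ^+ 2 = (p k).[x] ^+ 2 * w x.
Proof. by rewrite xiE exprMn amplitude_sqr mulrC. Qed.

(* The derivative of [xi k], and minus the ratio of its second derivative to
   [xi k], on the positive half-line only. *)
Definition xi' k x :=
  amplitude x * ((sigma / x - s * x) * (p k).[x] + (p k)^`().[x]).

Definition potential k x := s * (2 * k%:R + 1 + 2 * sigma) - s ^+ 2 * x ^+ 2
  - (sigma ^+ 2 - sigma + 2 * sigma * (odd k)%:R) / x ^+ 2.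

Lemma is_derive_xi k (x : R) : 0 < x ->
  is_derive x (1:R) (xi s sigma p k) (xi' k x).
Proof.
move=> x0; rewrite xiE; have da := is_derive_amplitude x0.
apply: is_derive_eq (is_deriveM da (is_derive_poly (p k) x)) _.
by rewrite /xi' /GRing.scale /=; ring.
Qed.

(** Liouville normal form: multiplying by the square root of the weight removes the first-order term
    of [orthonormal_ode]. *)
Lemma is_derive_xi' k (x : R) : 0 < x ->
  is_derive x (1:R) (xi' k) (- (potential k x * xi s sigma p k x)).
Proof.
move=> x0; rewrite xiE; have da := is_derive_amplitude x0.
have x_neq0 : x != 0 by rewrite gt_eqF.
have dh : is_derive x (1:R) (fun x => sigma / x - s * x) (- sigma / x ^+ 2 - s).
  have dV : is_derive x (1:R) (fun x : R => x^-1) (- x ^- 2).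
    have := @is_deriveV R id x 1 1 x_neq0 (is_derive_id _ _).
    by move=> h; apply: is_derive_eq h _; rewrite /GRing.scale /= mulr1.
  by apply: is_derive_eq; rewrite /GRing.scale /=; ring.
pose g x := (sigma / x - s * x) * (p k).[x] + (p k)^`().[x].
have dg : is_derive x (1:R) g ((- sigma / x ^+ 2 - s) * (p k).[x] +
    (sigma / x - s * x) * (p k)^`().[x] + (p k)^`()^`().[x]).
  apply: is_derive_eq (is_deriveD (is_deriveM dh (is_derive_poly (p k) x))
    (is_derive_poly (p k)^`() x)) _.
  by rewrite /GRing.scale /=; ring.
apply: is_derive_eq (is_deriveM da dg) _; rewrite /g.
have := congr1 (horner^~ x) (orthonormal_ode linL L_refl L_parts L_pos k opL).
rewrite !(hornerD, hornerN, hornerZ, hornerM, hornerX, hornerXn, hornerC) /= ?horner0.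
move: (amplitude x) => am ode.
rewrite /potential /GRing.scale /=.
move: (p k)^`()^`().[x] (p k)^`().[x] (p k).[x] ode => p2 p1 p0 ode.
have {ode} -> : p2 = - ((2 * sigma * x - 2 * s * (x * (x * x))) * p1 +
    (2 * s * k%:R * (x * x) - 2 * sigma * (odd k)%:R) * p0) / x ^+ 2.
  apply/(canRL (mulfK _)); first by rewrite expf_neq0.
  by move: ode; rewrite expr2; lra.
by field.
Qed.

Section quotient_bound.
Variables (k : nat) (y d D K m A : R).
Hypotheses (d0 : 0 < d) (D0 : 0 < D) (yD : D < y) (yd : d < y).
Hypothesis rooty : root (p k) y.
Hypothesis hK : forall x : R, y - d <= x <= y + d -> `|xi' k x| <= K.
Hypothesis hm : forall x : R, y - D <= x <= y + D -> `|xi s sigma p k x| <= m.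
Hypotheses (KA : K ^+ 2 <= A) (mA : m ^+ 2 / d ^+ 2 <= A).

(* An integrable majorant of [Num.min A (A d^2 / (x - y)^2)] with an explicit
   primitive. *)
Let bump x := 2 * A / (1 + ((x - y) / d) ^+ 2).

Let A0 : 0 <= A.
Proof. by apply: le_trans KA; rewrite sqr_ge0. Qed.

Let bump_den x : 0 < 1 + ((x - y) / d) ^+ 2.
Proof. by rewrite ltr_pwDl// sqr_ge0. Qed.

Let is_derive_bump x :
  is_derive x (1:R) (fun x => 2 * A * d * atan ((x - y) / d)) (bump x).
Proof.
have du : is_derive x (1:R) (fun x => (x - y) / d) d^-1.
  by apply: is_derive_eq; rewrite /GRing.scale /=; ring.
have da := is_derive1_comp (f := atan) (g := fun x => (x - y) / d)
  (is_derive1_atan _) du.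
have -> : bump x = (2 * A * d) *: ((1 + ((x - y) / d) ^+ 2)^-1 / d).
  rewrite /bump /GRing.scale /=; move: (1 + _) (bump_den x) => B B0.
  by field; rewrite !gt_eqF.
exact: is_deriveZ.
Qed.

Let continuous_bump : continuous bump.
Proof.
move=> x; apply: cvgM; first exact: cvg_cst.
apply: cvgV; first by rewrite gt_eqF.
apply: cvgD; first exact: cvg_cst.
apply: (@continuous_comp _ _ _ (fun x => (x - y) / d) (fun x => x ^+ 2)).
  by apply: cvgM; [apply: cvgB; [exact: cvg_id|exact: cvg_cst]|exact: cvg_cst].
exact: exprn_continuous.
Qed.

Let integral_bump : \int[mu]_(x in `[y - D, y + D]) (bump x) <= 2 * pi * A * d.
Proof.
have lt_yD : y - D < y + D by move: D0; lra.
have E := integral_is_derive lt_yD (fun x _ => is_derive_bump x)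
  (fun x _ => @continuous_bump x).
rewrite /Rintegral E /= -mulrBr.
have c0 : 0 <= 2 * A * d by rewrite !mulr_ge0// ltW.
have := atan_ltpi2 ((y + D - y) / d); have := atan_gtNpi2 ((y - D - y) / d).
move: (atan _) (atan _) => u v hu hv.
have -> : 2 * pi * A * d = 2 * A * d * pi by ring.
by rewrite ler_wpM2l//; lra.
Qed.

(** There are three zones. Within [d] of [y] the mean value theorem bounds the quotient by [K];
    between [d] and [D] the bound [m] on [xi k] gives [m ^ 2 / (x - y) ^ 2]; beyond [D] the
    denominator is at least [D ^ 2]. *)
Let quotient_pointwise q x : p k = q * ('X - y%:P) ->
  (q * q).[x] * w x <=
    (bump \_ `[y - D, y + D]) x + (D ^- 2) * ((p k * p k).[x] * w x).
Proof.
move=> pq.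
have px z : (p k).[z] = q.[z] * (z - y) by rewrite pq hornerM hornerXsubC.
have qxi : xi s sigma p k x ^+ 2 = q.[x] ^+ 2 * w x * (x - y) ^+ 2.
  by rewrite xi_sqr px; ring.
have w0 := weight_ge0 s sigma x.
have qw0 : 0 <= q.[x] ^+ 2 * w x by rewrite mulr_ge0// sqr_ge0.
have pw0 : 0 <= (p k * p k).[x] * w x by rewrite hornerM -expr2 mulr_ge0// sqr_ge0.
have memJ : (x \in (`[y - D, y + D]%classic : set R)) = (y - D <= x <= y + D).
  by apply/idP/idP; rewrite inE /= in_itv.
rewrite hornerM -expr2 patchE memJ; case: ifPn => xD; last first.
  rewrite add0r hornerM -expr2 px exprMn.
  rewrite [leRHS](_ : _ = (q.[x] ^+ 2 * w x) * ((x - y) ^+ 2 / D ^+ 2)); last by ring.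
  rewrite ler_peMr// ler_pdivlMr ?exprn_gt0// mul1r.
  have Dx : D < `|x - y|.
    by rewrite ltNge; apply: contra xD; rewrite ler_distl.
  by rewrite -[leRHS]real_normK ?num_real// lerXn2r ?nnegrE ?(ltW D0)// ltW.
apply: le_trans (_ : bump x <= _); last first.
  by rewrite lerDl mulr_ge0// invr_ge0 sqr_ge0.
have y0 : 0 < y by move: D0 yD; lra.
have [xd|xd] := lerP `|x - y| d.
  apply: (@le_trans _ _ A); last first.
    rewrite /bump ler_pdivlMr// mulrC ler_wpM2r//.
    suff : ((x - y) / d) ^+ 2 <= 1 by lra.
    rewrite -real_normK ?num_real// expr_le1// normrM normfV (gtr0_norm d0).
    by rewrite ler_pdivrMr// mul1r.
  apply: le_trans KA.
  (* At the zero itself the quotient is the derivative of [p k], and the left side becomes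
     [xi' k y ^ 2]. *)
  have [->|xy] := eqVneq x y.
    have h : `|xi' k y| <= K by apply: hK; move: d0; lra.
    have -> : q.[y] ^+ 2 * w y = `|xi' k y| ^+ 2.
      rewrite real_normK ?num_real// /xi' exprMn amplitude_sqr px.
      rewrite pq derivM derivXsubC !(hornerXsubC, hornerD, hornerM) hornerC.
      by ring.
    by rewrite lerXn2r ?nnegrE// (le_trans _ h).
  have xy0 : 0 < (x - y) ^+ 2 by rewrite exprn_even_gt0//= subr_eq0.
  have K0 : 0 <= K by apply: le_trans (hK (x := y) _) => //; move: d0; lra.
  rewrite -(ler_pM2r xy0) -qxi -exprMn -[leRHS]real_normK ?num_real//.
  rewrite -[leLHS]real_normK ?num_real// [`|K * _|]normrM (ger0_norm K0).
  rewrite lerXn2r ?nnegrE ?mulr_ge0//.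
  have -> : xi s sigma p k x = xi s sigma p k x - xi s sigma p k y.
    by rewrite xiE (eqP rooty) mulr0 subr0.
  have xd' : y - d <= x <= y + d by move: xd; rewrite ler_distlC; lra.
  apply: (derive_le_dist (a := y - d) (b := y + d) _ hK) => //; last by move: d0; lra.
  by move=> z /andP[zy _]; apply: is_derive_xi; move: yd; lra.
have xy0 : 0 < (x - y) ^+ 2.
  by rewrite -real_normK ?num_real// exprn_gt0// (lt_trans d0).
have m0 : `|xi s sigma p k x| ^+ 2 <= m ^+ 2.
  by have h := hm xD; rewrite lerXn2r ?nnegrE// (le_trans _ h).
have A1 : m ^+ 2 <= A * d ^+ 2 by rewrite -ler_pdivrMr ?exprn_gt0.
have dxy : d ^+ 2 <= (x - y) ^+ 2.
  by rewrite -[leRHS]real_normK ?num_real// lerXn2r ?nnegrE ?(ltW d0)// ltW.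
apply: (@le_trans _ _ (A * d ^+ 2 / (x - y) ^+ 2)).
  rewrite ler_pdivlMr// -qxi (le_trans _ A1)// (le_trans _ m0)//.
  by rewrite real_normK ?num_real.
have E0 : 0 < d ^+ 2 by rewrite exprn_gt0.
rewrite /bump expr_div_n; move: (d ^+ 2) ((x - y) ^+ 2) dxy E0 xy0 => E X EX E0 X0.
have -> : 2 * A / (1 + X / E) = 2 * A * E / (E + X) by field; rewrite !gt_eqF ?addr_gt0.
have EX0 : 0 < E + X by rewrite addr_gt0.
rewrite ler_pdivrMr// mulrAC ler_pdivlMr//.
have : 0 <= A * E * (X - E) by rewrite !mulr_ge0// ?subr_ge0// ltW.
lra.
Qed.

(** The left side is the exact value from [sqr_quotient_root]. On the right are the integral of
    [bump] and, since [p k] has norm 1, the far contribution. *)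
Lemma root_quotient_le : 2 * s <= 2 * pi * A * d + D ^- 2.
Proof.
have /factor_theorem[q pq] := rooty.
have y0 : y != 0 by rewrite gt_eqF; move: D0 yD; lra.
have <- := sqr_quotient_root linL L_refl L_parts opL y0 pq.
have intb : mu.-integrable setT (EFin \o (bump \_ `[y - D, y + D])).
  rewrite -restrict_EFin; apply: (@integrable_mkcond _ (measurableTypeR R) R mu
    `[y - D, y + D] (EFin \o bump) (measurable_itv _)).1.
  apply: continuous_compact_integrable; first exact: segment_compact.
  exact: continuous_subspaceT.
have intp := integrable_weighted op (p k * p k).
have intDp : mu.-integrable setT
    (EFin \o (fun x => D ^- 2 * ((p k * p k).[x] * w x))).
  exact: (integrableZl measurableT _ intp).
have h : L (q * q) <= \int[mu]_x ((bump \_ `[y - D, y + D]) x +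
    D ^- 2 * ((p k * p k).[x] * w x)).
  apply: (le_Rintegral (mu := mu)) => //.
  - exact: (integrable_weighted op).
  - exact: (integrableD measurableT intb intDp).
  - by move=> x _; exact: quotient_pointwise.
have [_ _ pp] := opL.
have Lp : \int[mu]_x (D ^- 2 * ((p k * p k).[x] * w x)) = D ^- 2.
  rewrite RintegralZl// -[X in _ * X]/(L (p k * p k)) pp eqxx mulr1 //.
apply: (le_trans h); rewrite RintegralD// Lp lerD2r -Rintegral_mkcond.
exact: integral_bump.
Qed.

End quotient_bound.

End orthonormal_functions.

(** * The turning point *)

Section turning_point.
Context {R : realType} (s sigma : R) (p : nat -> {poly R}).
Hypotheses (hs : 0 < s) (hsigma : - (1 / 2) < sigma).
Hypothesis op : orthonormal_polys s sigma p.

(* The turning point is [turning_root k ^ 3], and the oscillation of [xi k]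
   next to it has wavelength of order [(turning_root k)^-1]. *)
Definition turning_root k : R := ((2 * k%:R + 1 + 2 * sigma) / s) `^ (1 / 6).

(** Dominates the coefficient of [x ^- 2] in the potential, which is [sigma ^ 2 - sigma] or
    [sigma ^ 2 + sigma] according to the parity of [k]. *)
Definition centrifugal_bound := sigma ^+ 2 + `|sigma|.

Lemma turning_rootX6 k :
  s * turning_root k ^+ 6 = 2 * k%:R + 1 + 2 * sigma.
Proof.
have a0 : 0 <= (2 * k%:R + 1 + 2 * sigma) / s.
  apply: divr_ge0; last exact: ltW.
  have := ler0n R k; move: hsigma; lra.
rewrite /turning_root -powR_mulrn ?powR_ge0// -powRrM.
rewrite (_ : 1 / 6 * 6%:R = 1); last by field.
by rewrite powRr1// mulrC divfK// gt_eqF.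
Qed.

(** By [turning_rootX6] the constant term of the potential is [s ^ 2 * t ^ 6], so only the
    centrifugal term is left in the difference. *)
Lemma potential_near k x (t := turning_root k) : 1 <= x ->
  `|potential s sigma k x - s ^+ 2 * ((t ^+ 3 - x) * (t ^+ 3 + x))|
    <= centrifugal_bound.
Proof.
move=> x1; have x0 : 0 < x by lra.
rewrite /potential -turning_rootX6 -/t.
rewrite (_ : _ - _ = - ((sigma ^+ 2 - sigma + 2 * sigma * (odd k)%:R) / x ^+ 2)); last by ring.
rewrite normrN normrM normfV [`|x ^+ 2|]ger0_norm ?sqr_ge0//.
rewrite ler_pdivrMr ?exprn_gt0//.
apply: (@le_trans _ _ centrifugal_bound); last first.
  by rewrite ler_peMr ?exprn_ege1 ?addr_ge0 ?sqr_ge0.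
rewrite /centrifugal_bound; case: (odd k).
  rewrite [X in `|X|](_ : _ = sigma ^+ 2 + sigma); last by rewrite /=; ring.
  by rewrite (le_trans (ler_normD _ _))// ger0_norm ?sqr_ge0.
rewrite [X in `|X|](_ : _ = sigma ^+ 2 - sigma); last by rewrite /=; ring.
by rewrite (le_trans (ler_normB _ _))// ger0_norm ?sqr_ge0.
Qed.

Lemma root_xi k x : 0 < x -> xi s sigma p k x = 0 -> root (p k) x.
Proof.
move=> x0 /eqP; rewrite xiE mulf_eq0 => /orP[/eqP a0|//].
have := @weight_gt0 _ s sigma x; rewrite -amplitude_sqr a0 expr0n ltxx.
by move=> /(_ (lt0r_neq0 x0)).
Qed.

Lemma root_of_potential_ge k a kappa : 0 < a -> 0 < kappa ->
  (forall x, a <= x <= a + pi / kappa -> kappa ^+ 2 <= potential s sigma k x) ->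
  exists2 z, a <= z <= a + pi / kappa & root (p k) z.
Proof.
move=> a0 k0 hQ.
have [||z az xz] := sturm_sin (f := xi s sigma p k) (f1 := xi' s sigma p k) k0 _ _ hQ.
- by move=> x /andP[ax _]; apply: is_derive_xi; exact: lt_le_trans ax.
- move=> x /andP[ax _]; apply: (is_derive_xi' hs hsigma op).
  exact: lt_le_trans ax.
by exists z => //; apply: root_xi => //; case/andP: az => + _; exact: lt_le_trans.
Qed.

(* [edge_width >= pi / s] is what Sturm comparison with frequency [s * t]
   requires on an interval of length [edge_width / t]; [edge_slope] is the
   constant produced by Landau's inequality on an interval twice as long. *)
Definition edge_width : R := 2 + pi / s.

Definition edge_slope : R := edge_width^-1 + 14 * s ^+ 2 * edge_width ^+ 2.

Lemma edge_width_ge2 : 2 <= edge_width.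
Proof. by rewrite /edge_width lerDl divr_ge0 ?pi_ge0// ltW. Qed.

Section large_index.
Variables (k : nat).
Local Notation t := (turning_root k).
(** Thresholds that hold for all large [k]. [t_cent] absorbs the centrifugal term, [t_pi] lets half
    a wave fit between [t ^ 3 / 4] and [t ^ 3 / 2], [t_edge] gives [12 * d <= 1], and [t_s] keeps
    the outer radius below [t / 4]. *)
Hypothesis t_ge4 : 4 <= t.
Hypothesis t_cent : centrifugal_bound <= s ^+ 2 / 2 * t.
Hypothesis t_pi : 8 * pi / s <= t.
Hypothesis t_edge : 12 * edge_width <= t.
Hypothesis t_s : 4 * (Num.sqrt s)^-1 <= t.

Let t_le n : t <= t ^+ n.+1.
Proof. by rewrite -{1}[t]expr1 ler_weXn2l//; move: t_ge4; lra. Qed.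

Let t0 : 0 < t. Proof. by move: t_ge4; lra. Qed.

Let s2 : 0 < s ^+ 2. Proof. exact: exprn_gt0. Qed.

(** This places the smallest positive zero left of [t ^ 3 / 2], hence left of the region used by
    [edge_bound]. With [T = t ^ 3], up to [T / 2] the potential is at least [3/4 - 1/2] times
    [s ^ 2 T ^ 2], the square of the frequency [s T / 2]. *)
Lemma inner_root : exists2 z, root (p k) z & 0 < z <= t ^+ 3 / 2.
Proof.
pose T := t ^+ 3; have T4 : 4 <= T by apply: le_trans (t_le 2).
have T0 : 0 < T by lra.
have k0 : 0 < s * T / 2 by rewrite divr_gt0// mulr_gt0.
have T8 : 8 * pi / s <= T ^+ 2.
  by rewrite -exprM; apply: le_trans t_pi _; exact: (t_le 5).
have hT : T / 4 + pi / (s * T / 2) <= T / 2.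
  suff : pi / (s * T / 2) <= T / 4 by lra.
  rewrite ler_pdivrMr// [leRHS](_ : _ = s * T ^+ 2 / 8); last by field.
  by have : 8 * pi <= T ^+ 2 * s by [rewrite -ler_pdivrMr]; lra.
have [||z /andP[z1 z2] rz] := @root_of_potential_ge k (T / 4) (s * T / 2) _ k0.
- by lra.
- move=> x /andP[x1 x2].
  have x1' : 1 <= x by lra.
  have /ler_normlP[h _] := potential_near k x1'; rewrite -/T in h.
  have c : centrifugal_bound <= s ^+ 2 / 2 * T ^+ 2.
    apply: le_trans t_cent _; rewrite ler_wpM2l//; first by rewrite divr_ge0// ltW.
    by rewrite -exprM; exact: (t_le 5).
  have xx : x ^+ 2 <= T ^+ 2 / 4.
    rewrite (_ : T ^+ 2 / 4 = (T / 2) ^+ 2); last by field.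
    by rewrite lerXn2r ?nnegrE; lra.
  have : s ^+ 2 * (3 / 4 * T ^+ 2) <= s ^+ 2 * ((T - x) * (T + x)).
    by apply: ler_wpM2l; [exact: ltW|lra].
  rewrite (_ : (s * T / 2) ^+ 2 = s ^+ 2 * T ^+ 2 / 4); last by field.
  lra.
by exists z => //; apply/andP; split; rewrite -/T; lra.
Qed.

Let l0 : 0 < edge_width.
Proof. by have := edge_width_ge2; lra. Qed.

Let d := edge_width / t.

Let d0 : 0 < d.
Proof. by rewrite divr_gt0. Qed.

Let d_le1 : 12 * d <= 1.
Proof. by rewrite /d mulrA ler_pdivrMr// mul1r. Qed.

Let cube_ge : 4 * t <= t ^+ 3.
Proof.
rewrite exprS mulrC ler_pM2l//; apply: le_trans t_ge4 _.
exact: (t_le 1).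
Qed.

(** At distance at least [d] from the turning point, [(t ^ 3 - x) * (t ^ 3 + x)] is at least
    [d t ^ 3 = edge_width * t ^ 2 >= 2 t ^ 2]. The centrifugal term costs at most [s ^ 2 t ^ 2 / 2],
    so the frequency is at least [s t], and half a wave fits into length [d]. *)
Lemma edge_root : exists2 y, root (p k) y & t ^+ 3 - 2 * d <= y <= t ^+ 3 - d.
Proof.
have k0 : 0 < s * t by rewrite mulr_gt0.
have hpi : pi / (s * t) <= d.
  rewrite /d ler_pdivrMr// [leRHS](_ : _ = edge_width * s); last first.
    by field; rewrite gt_eqF.
  by rewrite -ler_pdivrMr// /edge_width lerDr.
have [||y /andP[y1 y2] ry] := @root_of_potential_ge k (t ^+ 3 - 2 * d) (s * t) _ k0.
- by move: cube_ge d_le1 t_ge4; lra.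
- move=> x /andP[x1 x2].
  have x1' : 1 <= x by move: cube_ge d_le1 t_ge4; lra.
  have /ler_normlP[h _] := potential_near k x1'.
  have h1 : d * t ^+ 3 <= (t ^+ 3 - x) * (t ^+ 3 + x).
    apply: ler_pM; rewrite ?(ltW d0) ?exprn_ge0 ?(ltW t0)//; lra.
  have dt : d * t ^+ 3 = edge_width * t ^+ 2 by rewrite /d; field; rewrite gt_eqF.
  have h2 : s ^+ 2 * (2 * t ^+ 2) <= s ^+ 2 * ((t ^+ 3 - x) * (t ^+ 3 + x)).
    apply: ler_wpM2l; first exact: ltW.
    apply: le_trans h1; rewrite dt ler_wpM2r ?sqr_ge0//.
    exact: edge_width_ge2.
  have c : centrifugal_bound <= s ^+ 2 / 2 * t ^+ 2.
    apply: le_trans t_cent _; apply: ler_wpM2l; last exact: (t_le 1).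
    by rewrite divr_ge0// ltW.
  have := mulr_ge0 (ltW s2) (sqr_ge0 t).
  rewrite exprMn; lra.
by exists y => //; apply/andP; split; lra.
Qed.

(** At the zero from [edge_root], Landau's inequality turns [m] into a slope bound
    [K = m * t * edge_slope]; [root_quotient_le] with [A = K ^ 2] then gives the claim. *)
Lemma edge_bound (m : R) :
  (forall x, t ^+ 3 / 2 <= x -> `|xi s sigma p k x| <= m) ->
  s <= 2 * pi * edge_width * edge_slope ^+ 2 * (m ^+ 2 * t).
Proof.
move=> hm; have [y ry /andP[y1 y2]] := edge_root.
have m0 : 0 <= m by apply: le_trans (hm (t ^+ 3 / 2) (lexx _)).
(* With this radius the far part is exactly [s], half of the total [2 s]. *)
pose D : R := (Num.sqrt s)^-1.
have D0 : 0 < D by rewrite invr_gt0 sqrtr_gt0.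
have D2 : D ^- 2 = s by rewrite /D exprVn invrK sqr_sqrtr// ltW.
have cg := cube_ge; have d1 := d_le1; have t4 := t_ge4; have ts := t_s.
have dp := d0.
have {}ts : 4 * D <= t by [].
have far (x : R) : y - D <= x -> t ^+ 3 / 2 <= x by move: cg d1 t4 dp ts y1; lra.
have near (x : R) : y - d <= x -> t ^+ 3 / 2 <= x by move: cg d1 t4 dp y1; lra.
(* Points within [d] of [y] lie at most [3 d] left of [t ^ 3], where the main part of the potential
   is at most [s ^ 2 * 3 d * 2 t ^ 3 = 6 s ^ 2 * edge_width * t ^ 2]; the centrifugal term supplies
   the seventh unit. *)
pose B := 7 * s ^+ 2 * edge_width * t ^+ 2 * m.
have hpot (x : R) : y - d <= x <= y + d ->
    `|- (potential s sigma k x * xi s sigma p k x)| <= B.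
  move=> /andP[x1 x2].
  have x1' : 1 <= x by lra.
  have hd := potential_near k x1'.
  rewrite normrN normrM; apply: ler_pM => //; last by apply: hm; exact: near.
  have h1 : `|s ^+ 2 * ((t ^+ 3 - x) * (t ^+ 3 + x))| <= s ^+ 2 * (3 * d * (2 * t ^+ 3)).
    have h3 : 0 <= t ^+ 3 - x by move: y2 x2; lra.
    have h4 : 0 <= t ^+ 3 + x by move: x1' cg t4; lra.
    rewrite (ger0_norm (mulr_ge0 (ltW s2) (mulr_ge0 h3 h4))).
    apply: ler_wpM2l; first exact: ltW.
    by apply: ler_pM => //; move: y1 y2 x1 x2; lra.
  have dt : d * t ^+ 3 = edge_width * t ^+ 2 by rewrite /d; field; rewrite gt_eqF.
  have c : centrifugal_bound <= s ^+ 2 * edge_width * t ^+ 2.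
    apply: le_trans t_cent _; apply: (@le_trans _ _ (s ^+ 2 * edge_width * t)).
      apply: ler_wpM2r; first exact: ltW.
      by apply: ler_wpM2l; [exact: ltW|have := edge_width_ge2; lra].
    apply: ler_wpM2l; last exact: (t_le 1).
    by rewrite mulr_ge0// ltW.
  have := ler_normD (potential s sigma k x - s ^+ 2 * ((t ^+ 3 - x) * (t ^+ 3 + x)))
    (s ^+ 2 * ((t ^+ 3 - x) * (t ^+ 3 + x))).
  rewrite subrK => h2.
  apply: (le_trans h2); apply: (le_trans (lerD hd h1)).
  rewrite (_ : s ^+ 2 * (3 * d * (2 * t ^+ 3)) = 6 * s ^+ 2 * (d * t ^+ 3)); last by ring.
  by rewrite dt; lra.
have hK (x : R) : y - d <= x <= y + d -> `|xi' s sigma p k x| <= m * t * edge_slope.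
  move=> xd.
  have := @derive_le_landau R (xi s sigma p k) (xi' s sigma p k)
    (fun x => - (potential s sigma k x * xi s sigma p k x)) (y - d) (y + d) m B.
  rewrite (_ : y + d - (y - d) = 2 * d); last by ring.
  rewrite (_ : m * t * edge_slope = 2 * m / (2 * d) + B * (2 * d)).
    apply => //.
    - by lra.
    - by move=> z /andP[z1 _]; apply: is_derive_xi; lra.
    - by move=> z /andP[z1 _]; apply: (is_derive_xi' hs hsigma op); lra.
    - by move=> z /andP[z1 _]; apply: hm; exact: near.
  rewrite /edge_slope /B /d; field.
  by rewrite !gt_eqF.
have := @root_quotient_le R s sigma p hs hsigma op k y d D (m * t * edge_slope) m
  ((m * t * edge_slope) ^+ 2) d0 D0.
rewrite D2; set A := (_ ^+ 2).
have -> : 2 * pi * edge_width * edge_slope ^+ 2 * (m ^+ 2 * t) = 2 * pi * A * d.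
  by rewrite /A /d; field; rewrite gt_eqF.
move=> h; suff : 2 * s <= 2 * pi * A * d + s by lra.
apply: h => //.
- lra.
- lra.
- by move=> x /andP[x1 _]; apply: hm; exact: far.
(* Hence [m / d <= K], so the same [A] also covers the middle zone. *)
have slope_ge : edge_width^-1 <= edge_slope.
  by rewrite /edge_slope lerDl; apply: mulr_ge0; [apply: mulr_ge0|]; rewrite ?sqr_ge0.
have slope0 : 0 <= edge_slope by apply: le_trans slope_ge; rewrite invr_ge0 ltW.
have t0' := ltW t0.
rewrite /A -expr_div_n lerXn2r ?nnegrE ?mulr_ge0 ?invr_ge0 ?(ltW dp)//.
rewrite (_ : m / d = m * t * edge_width^-1); last by rewrite /d; field; rewrite !gt_eqF.
by apply: ler_wpM2l; rewrite ?mulr_ge0.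
Qed.

End large_index.
End turning_point.

(** * The lower bound for large indices, uniformly in the family *)

Section lower_bound.
Context {R : realType} (s sigma : R).
Hypotheses (hs : 0 < s) (hsigma : - (1 / 2) < sigma).

Lemma turning_root_le k : (0 < k)%N ->
  turning_root s sigma k <=
  ((3 + 2 * `|sigma|) / s) `^ (1 / 6) * k%:R `^ (1 / 6).
Proof.
move=> k0; have k1 : 1 <= k%:R :> R by rewrite ler1n.
have hs' := hs; have hsigma' := hsigma.
have c0 : 0 <= 3 + 2 * `|sigma| by have := normr_ge0 sigma; lra.
rewrite -powRM ?divr_ge0 ?(ltW hs)//.
apply: ge0_ler_powR; rewrite ?nnegrE.
- by lra.
- by apply: divr_ge0; [lra|exact: ltW].
- by rewrite mulr_ge0// divr_ge0// ltW.
rewrite mulrAC ler_wpM2r ?invr_ge0 ?(ltW hs)//.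
have : 1 + 2 * sigma <= (1 + 2 * `|sigma|) * k%:R.
  apply: (@le_trans _ _ (1 + 2 * `|sigma|)); first by have := ler_norm sigma; lra.
  by rewrite ler_peMr//; have := normr_ge0 sigma; lra.
lra.
Qed.

Lemma turning_root_ge (c : R) : 0 <= c ->
  exists N, forall k, (N <= k)%N -> c <= turning_root s sigma k.
Proof.
move=> c0; exists (Num.bound (s * c ^+ 6)) => k Nk.
have hs' := hs; have hsigma' := hsigma.
have k_ge : s * c ^+ 6 <= k%:R.
  apply: (@le_trans _ _ (Num.bound (s * c ^+ 6))%:R); last by rewrite ler_nat.
  by apply/ltW/archi_boundP; rewrite mulr_ge0 ?exprn_ge0 ?(ltW hs).
have a0 : c ^+ 6 <= (2 * k%:R + 1 + 2 * sigma) / s.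
  by rewrite ler_pdivlMr// mulrC; have := ler0n R k; lra.
have cE : c = (c ^+ 6) `^ (1 / 6).
  rewrite -powR_mulrn// -powRrM (_ : 6%:R * (1 / 6) = 1); last by field.
  by rewrite powRr1.
rewrite cE; apply: (ge0_ler_powR _ _ _ a0); rewrite ?nnegrE ?exprn_ge0//.
by apply: le_trans a0; rewrite exprn_ge0.
Qed.

(** By contradiction: if [xi k ^ 2] stayed below [b] beyond [t ^ 3 / 2], then [edge_bound] with
    [m = Num.sqrt b] would give [s <= M * b * t], whereas [turning_root_le] gives
    [b * t <= c * C6]. *)
Lemma xi_large_index : exists (c : R) N, 0 < c /\
  forall p, orthonormal_polys s sigma p -> forall k, (N <= k)%N -> (0 < k)%N ->
  exists x z, [/\ 0 < z, root (p k) z, z <= x &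
    c * k%:R `^ (- (1 / 6)) <= xi s sigma p k x ^+ 2].
Proof.
pose C6 := ((3 + 2 * `|sigma|) / s) `^ (1 / 6).
pose M := 2 * pi * edge_width s * edge_slope s ^+ 2.
have hs' := hs; have hsigma' := hsigma.
have ew2 := edge_width_ge2 hs.
have slope0 : 0 < edge_slope s.
  apply: ltr_pwDl; first by rewrite invr_gt0; lra.
  by apply: mulr_ge0; [apply: mulr_ge0|]; rewrite ?sqr_ge0.
have M0 : 0 < M.
  apply: mulr_gt0; last exact: exprn_gt0.
  by rewrite !mulr_gt0 ?pi_gt0//; lra.
have C0 : 0 < C6.
  by rewrite powR_gt0// divr_gt0//; have := normr_ge0 sigma; lra.
(* Half the critical value: it makes [M * (c * C6)] equal to [s / 2]. *)
pose c := s / (2 * M * C6).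
have c0 : 0 < c by rewrite divr_gt0// mulr_gt0// mulr_gt0.
(* A sum of nonnegative thresholds, so that [T <= t] implies each of them. *)
pose T := 4 + centrifugal_bound sigma / (s ^+ 2 / 2) + 8 * pi / s + 12 * edge_width s +
  4 * (Num.sqrt s)^-1.
have T1 : 0 <= centrifugal_bound sigma / (s ^+ 2 / 2).
  by rewrite divr_ge0 ?addr_ge0 ?divr_ge0 ?sqr_ge0.
have T2 : 0 <= 8 * pi / s by rewrite divr_ge0 ?mulr_ge0 ?pi_ge0 ?ltW.
have T3 : 0 <= 4 * (Num.sqrt s)^-1 by rewrite mulr_ge0// invr_ge0 sqrtr_ge0.
have T0 : 0 <= T by rewrite /T; lra.
have [N hN] := turning_root_ge T0.
exists c, N; split => // p op k Nk k0.
set t := turning_root s sigma k; have tT : T <= t by exact: hN.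
have t_cent : centrifugal_bound sigma <= s ^+ 2 / 2 * t.
  rewrite mulrC -ler_pdivrMr ?divr_gt0 ?exprn_gt0//; move: tT; rewrite /T; lra.
have t4 : 4 <= t by move: tT; rewrite /T; lra.
have tpi : 8 * pi / s <= t by move: tT; rewrite /T; lra.
have tew : 12 * edge_width s <= t by move: tT; rewrite /T; lra.
have ts : 4 * (Num.sqrt s)^-1 <= t by move: tT; rewrite /T; lra.
have [z rz /andP[z0 zt]] := inner_root hs hsigma op t4 t_cent tpi.
apply: contrapT => H.
pose b := c * k%:R `^ (- (1 / 6)).
have kp : 0 < k%:R `^ (1 / 6) :> R by rewrite powR_gt0 ?ltr0n.
have b0 : 0 < b by rewrite mulr_gt0 ?powR_gt0 ?ltr0n.
have hm x : t ^+ 3 / 2 <= x -> `|xi s sigma p k x| <= Num.sqrt b.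
  move=> tx; rewrite -sqrtr_sqr ler_wsqrtr// ltW// ltNge; apply/negP => bx.
  by apply: H; exists x, z; split => //; exact: le_trans tx.
have := edge_bound hs hsigma op t4 t_cent tew ts hm.
rewrite (sqr_sqrtr (ltW b0)) -/M -/t.
have : b * t <= c * C6.
  rewrite /b powRN -mulrA ler_pM2l// mulrC ler_pdivrMr//.
  exact: turning_root_le.
rewrite -(ler_pM2l M0) => h /le_trans /(_ h).
rewrite (_ : M * (c * C6) = s / 2); last by rewrite /c; field; rewrite !gt_eqF.
lra.
Qed.

End lower_bound.

(** * Attained maxima *)

Section maximum.
Context {R : realType}.

(** Outside a large segment [f] is at most [f x0], so the maximum over the compact part is
    global. *)
Lemma is_max_on_decay (D : set R) (f : R -> R) (x0 : R) :
  closed D -> {within D, continuous f} -> D x0 -> 0 < f x0 ->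
  (forall e, 0 < e -> exists B, forall x, B <= `|x| -> f x <= e) ->
  exists2 M, is_max_on D f M & f x0 <= M.
Proof.
move=> cD cf Dx0 fx0 decay.
have [B hB] := decay _ fx0.
pose r := Num.max B `|x0|.
pose A := `[- r, r]%classic `&` D.
have Ax0 : A x0.
  split => //=; rewrite in_itv/= -ler_norml /r le_max lexx orbT //.
have [||c cA hc] := @compact_EVT_max R R f A (ex_intro _ _ Ax0).
- by apply: compact_closedI => //; exact: segment_compact.
- by apply: continuous_subspaceW cf; exact: subIsetr.
have [_ Dc] : A c by rewrite inE in cA.
have hx0 : f x0 <= f c by apply: hc; rewrite inE.
exists (f c) => //; split; first by exists c.
move=> x Dx; have [rx|xr] := leP r `|x|.
  by apply: le_trans hx0; apply: hB; rewrite (le_trans _ rx)// le_max lexx.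
by apply: hc; rewrite inE; split => //=; rewrite in_itv/= -ler_norml ltW.
Qed.

Lemma weight_continuous_neq0 (s sigma x : R) : x != 0 ->
  {for x, continuous (weight s sigma)}.
Proof.
move=> x0; have [xn|xp|/eqP] := ltgtP x 0; last by rewrite (negbTE x0).
  rewrite (_ : weight s sigma = weight s sigma \o -%R); last first.
    by apply/funext => y; rewrite /= weightN.
  apply: continuous_comp; first exact: opp_continuous.
  apply: is_derive_continuous (is_derive_weight s sigma _).
  by rewrite oppr_gt0.
exact: is_derive_continuous (is_derive_weight s sigma xp).
Qed.

Lemma weight_continuous (s sigma : R) : 0 <= sigma ->
  continuous (weight s sigma).
Proof.
rewrite le_eqVlt => /predU1P[<-|sigma0] x.
  apply: cvgM.
    (* For [sigma = 0] the power is the constant 1, at [x = 0] too. *)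
    rewrite mulr0; under eq_fun do rewrite powRr0; rewrite powRr0.
    exact: cvg_cst.
  apply: continuous_comp; last exact: continuous_expR.
  by apply: cvgN; apply: cvgM; [exact: cvg_cst|exact: exprn_continuous].
have [->|x0] := eqVneq x 0; last exact: weight_continuous_neq0.
apply: cvgM; last first.
  apply: continuous_comp; last exact: continuous_expR.
  by apply: cvgN; apply: cvgM; [exact: cvg_cst|exact: exprn_continuous].
have a0 : 0 < 2 * sigma by lra.
rewrite normr0 powR0 ?gt_eqF//.
apply/cvgr0Pnorm_le => e e0.
have d0 : 0 < e `^ (2 * sigma)^-1 by rewrite powR_gt0.
have eE : e = (e `^ (2 * sigma)^-1) `^ (2 * sigma).
  by rewrite -powRrM mulVf ?gt_eqF// powRr1 // ltW.
near=> y.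
rewrite ger0_norm ?powR_ge0// [leRHS]eE.
apply: ge0_ler_powR; rewrite ?nnegrE ?powR_ge0 ?(ltW a0)//.
Unshelve. all: by end_near. Qed.

End maximum.

(** * Extension to every index, and continuity of [xi k ^ 2] *)

Section lower_bound_all_indices.
Context {R : realType} (s sigma : R).
Hypotheses (hs : 0 < s) (hsigma : - (1 / 2) < sigma).

Lemma xi_sqr_decay p k (e : R) : 0 < e ->
  exists B, forall x, B <= `|x| -> xi s sigma p k x ^+ 2 <= e.
Proof.
move=> e0; have [C hC] := weight_decay sigma hs (p k * p k).
exists (Num.max 1 (C / e)) => x; rewrite ge_max => /andP[x1 Cx].
have x0 : 0 < `|x| by exact: lt_le_trans x1.
rewrite xi_sqr expr2 -hornerM; apply: le_trans (ler_norm _) _.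
by apply: le_trans (hC x x1) _; rewrite ler_pdivrMr// mulrC -ler_pdivrMr.
Qed.

Lemma orthonormal_polys_uniq p q : orthonormal_polys s sigma p ->
  orthonormal_polys s sigma q -> p = q.
Proof.
move=> op oq; apply/funext.
exact: (orthonormal_uniq (weighted_integral_linear op)
  (weighted_integral_orthonormal op) (weighted_integral_orthonormal oq)).
Qed.

Lemma middle_zero p k : orthonormal_polys s sigma p -> ~~ odd k -> (0 < k)%N ->
  0 < zero_of p k (k %/ 2) /\
  (forall z, root (p k) z -> 0 < z -> zero_of p k (k %/ 2) <= z).
Proof.
move=> op; apply: (orthonormal_middle_root (weighted_integral_linear op)
  (weighted_integral_gt0 op) (weighted_integral_refl op)).
exact: weighted_integral_orthonormal.
Qed.

(** Each index contributes one positive value and the minimum of these is kept. By uniqueness the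
    value found for one family [p0] serves all, so [c] precedes [p]; without any family the claim is
    vacuous. *)
Lemma xi_small_index N : exists2 c : R, 0 < c &
  forall p, orthonormal_polys s sigma p -> forall k, (k < N)%N -> (0 < k)%N ->
  exists x, [/\ 0 < x, (~~ odd k -> zero_of p k (k %/ 2) <= x) &
    c * k%:R `^ (- (1 / 6)) <= xi s sigma p k x ^+ 2].
Proof.
elim: N => [|N [c c0 hc]]; first by exists 1.
have [N0|N0] := posnP N.
  by exists c => // p op k; rewrite ltnS N0 leqn0 => /eqP ->.
have [[p0 op0]|np] := pselect (exists p, orthonormal_polys s sigma p); last first.
  by exists c => // p op; exfalso; apply: np; exists p.
have pN0 : p0 N != 0 by have [sp _ _] := op0; rewrite -size_poly_eq0 sp.
(* The maximum with 0 keeps [x] positive for odd [N] as well. *)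
have [x] := poly_neq0_gt (Num.max 0 (zero_of p0 N (N %/ 2))) pN0.
rewrite gt_max => /andP[x0 zx] px.
pose b := xi s sigma p0 N x ^+ 2.
have b0 : 0 < b.
  by rewrite /b xi_sqr mulr_gt0 ?exprn_even_gt0//= weight_gt0 ?gt_eqF.
have N6 : 0 < N%:R `^ (1 / 6) :> R by rewrite powR_gt0 ?ltr0n.
exists (Num.min c (b * N%:R `^ (1 / 6))); first by rewrite lt_min c0 mulr_gt0.
move=> p op k; rewrite ltnS leq_eqVlt => /predU1P[->|kN] k0.
  rewrite (orthonormal_polys_uniq op op0); exists x; split => // [_|].
    exact: ltW.
  rewrite -/b powRN -ler_pdivlMr ?invr_gt0// invrK.
  by rewrite ge_min lexx orbT.
have [y [y0 zy hy]] := hc p op k kN k0.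
exists y; split => //; apply: le_trans hy.
by rewrite ler_wpM2r ?powR_ge0// ge_min lexx.
Qed.

Lemma xi_all_indices : exists2 c : R, 0 < c &
  forall p, orthonormal_polys s sigma p -> forall k, (0 < k)%N ->
  exists x, [/\ 0 < x, (~~ odd k -> zero_of p k (k %/ 2) <= x) &
    c * k%:R `^ (- (1 / 6)) <= xi s sigma p k x ^+ 2].
Proof.
have [c [N [c0 hc]]] := xi_large_index hs hsigma.
have [c' c'0 hc'] := xi_small_index N.
exists (Num.min c c') => [|p op k k0]; first by rewrite lt_min c0.
have [kN|Nk] := ltnP k N.
  have [x [x0 zx hx]] := hc' p op k kN k0.
  exists x; split => //; apply: le_trans hx.
  by rewrite ler_wpM2r ?powR_ge0// ge_min lexx orbT.
have [x [z [z0 rz zx hx]]] := hc p op k Nk k0.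
exists x; split; first exact: lt_le_trans zx.
  by move=> ek; have [_ /(_ z rz z0) /le_trans] := middle_zero op ek k0; apply.
by apply: le_trans hx; rewrite ler_wpM2r ?powR_ge0// ge_min lexx.
Qed.

Lemma xi_sqr_continuous p k : orthonormal_polys s sigma p ->
  odd k || (0 <= sigma) -> continuous (fun x => xi s sigma p k x ^+ 2).
Proof.
move=> op /orP[ok|sigma0]; last first.
  move=> x; under eq_fun do rewrite xi_sqr; rewrite ?xi_sqr.
  apply: cvgM; last exact: weight_continuous.
  apply: (@continuous_comp _ _ _ (horner (p k)) (fun y => y ^+ 2)).
    exact: continuous_horner.
  exact: exprn_continuous.
(* The factor ['X] of [p k] absorbs the singularity: it replaces [sigma] by
   [sigma + 1]. *)
have [u pu] : exists u, p k = u * 'X.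
  have /factor_theorem[u ->] : root (p k) 0; last by exists u; rewrite subr0.
  rewrite /root horner_coef0; apply/eqP.
  apply: (coef_parity (weighted_integral_linear op) (weighted_integral_refl op)
    (weighted_integral_orthonormal op)).
  by rewrite ok.
have xiE2 x : xi s sigma p k x ^+ 2 = u.[x] ^+ 2 * weight s (sigma + 1) x.
  rewrite xi_sqr pu hornerM hornerX exprMn /weight.
  have [->|x0] := eqVneq x 0.
    rewrite expr0n mulr0 mul0r normr0 powR0 ?mul0r ?mulr0//.
    by rewrite gt_eqF//; move: hsigma; lra.
  rewrite mulrDr mulr1 powRD ?normr_eq0 ?x0 ?implybT// powR_mulrn//.
  by rewrite real_normK ?num_real//; ring.
move=> x; under eq_fun do rewrite xiE2; rewrite ?xiE2.
apply: cvgM; last by apply: weight_continuous; move: hsigma; lra.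
apply: (@continuous_comp _ _ _ (horner u) (fun y => y ^+ 2)).
  exact: continuous_horner.
exact: exprn_continuous.
Qed.

Lemma xi_sqr_continuous_neq0 p k x : x != 0 ->
  {for x, continuous (fun x => xi s sigma p k x ^+ 2)}.
Proof.
move=> x0; rewrite /prop_for /continuous_at.
under eq_fun do rewrite xi_sqr; rewrite ?xi_sqr.
apply: cvgM; last exact: weight_continuous_neq0.
apply: (@continuous_comp _ _ _ (horner (p k)) (fun y => y ^+ 2)).
  exact: continuous_horner.
exact: exprn_continuous.
Qed.

End lower_bound_all_indices.

Theorem theorem1p3 (R : realType) (s sigma : R) (hs : 0 < s)
    (hsigma : - (1 / 2) < sigma) :
  exists C4 C5 : R, [/\ 0 < C4, 0 < C5 &
    forall p : nat -> {poly R}, orthonormal_polys s sigma p ->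
    forall k : nat, (1 <= k)%N ->
      max_xi2_ge s sigma p k (C4 * k%:R `^ (- (1 / 6)))
      /\
      (~~ odd k -> sigma < 0 ->
        exists2 M : R,
          is_max_on [set x | zero_of p k (k %/ 2)%N <= `|x|]
            (fun x => xi s sigma p k x ^+ 2) M
          & C5 * k%:R `^ (- (1 / 6)) <= M)].
Proof.
have [c c0 hc] := xi_all_indices hs hsigma.
(* One point [x], lying beyond the smallest positive zero when [k] is even, witnesses both
   bounds. *)
exists c, c; split => // p op k k0.
have [x [x0 zx hx]] := hc p op k k0.
have b0 : 0 < c * k%:R `^ (- (1 / 6)) by rewrite mulr_gt0 ?powR_gt0 ?ltr0n.
have fx0 : 0 < xi s sigma p k x ^+ 2 by exact: lt_le_trans hx.
have decay := xi_sqr_decay sigma hs p k.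
split.
  rewrite /max_xi2_ge; case: ifPn => [_|].
    apply: (@le_trans _ _ (xi s sigma p k x ^+ 2)%:E); first by rewrite lee_fin.
    by apply: ereal_sup_ubound; exists x => //=; rewrite gt_eqF.
  rewrite negb_and negbK -leNgt => ok.
  have [|||M maxM xM] := @is_max_on_decay R setT
    (fun x => xi s sigma p k x ^+ 2) x closedT _ _ fx0.
  - exact/continuous_subspaceT/(xi_sqr_continuous hsigma op).
  - by [].
  - exact: decay.
  by exists M => //; exact: le_trans xM.
move=> ek _; have [z0 _] := middle_zero op ek k0.
have [||||M maxM xM] := @is_max_on_decay R
  [set x | zero_of p k (k %/ 2)%N <= `|x|] (fun x => xi s sigma p k x ^+ 2) x _ _ _ fx0.
- apply: (@preimage_closed _ _ (fun x : R => `|x|) [set y | zero_of p k (k %/ 2)%N <= y]).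
    by move=> y _; exact: norm_continuous.
  exact: closed_ge.
(* The middle zero is positive, so the domain avoids the singularity at 0. *)
- apply: continuous_in_subspaceT => y; rewrite inE /= => zy.
  by apply: xi_sqr_continuous_neq0; rewrite -normr_gt0 (lt_le_trans z0).
- by rewrite /= gtr0_norm// zx.
- exact: decay.
by exists M => //; exact: le_trans xM.
Qed.
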